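(* Let $0<\alpha<1$, $0\le\beta\le 1$, $\gamma=\alpha+\beta(1-\alpha)$, $\rho>0$, $x_0\in\mathbb{R}$. Let $\varphi:\mathbb{R}^{+}\times\mathbb{R}\to\mathbb{R}$ be a continuous function (possibly with a weak singularity with respect to $t$ at $t=0$) satisfying a Lipschitz condition $|\varphi(t,x)-\varphi(t,y)|\le A|x-y|$ with a constant $A>0$. Suppose there exists a constant $0\le\lambda<1$ such that $(\mathcal{M}x)(t)=t^{\lambda}\varphi(t,x(t))$ defines a continuous bounded map from $C_{1-\gamma,\rho}[0,T]$ into $C[0,T]$, where $T$ is a positive constant. Let $x=x(t)$, $t\in(0,\mu)$, be a solution of the initial value problem $${}_{\rho}D^{\alpha,\beta}_{0+}x(t)=\varphi(t,x(t)),\quad t>0,\qquad {}_{\rho}I^{1-\gamma}_{0+}x(t)\big|_{t=0}=x_0 .$$ Then $x$ is non-continuable if and only if $$\limsup_{t\to\mu^{-}}|\Phi(t)|=+\infty,$$ where $\Phi(t)=(t,x(t))$ and $|\Phi(t)|=\sqrt{t^{2}+x^{2}(t)}$.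
   Context: $\mathbb{R}^+=(0,\infty)$; $0<\mu\le+\infty$. For a finite $T>0$, $C_{1-\gamma,\rho}[0,T]$ is the space of functions $x:(0,T]\to\mathbb{R}$ such that $(t^{\rho}/\rho)^{1-\gamma}x(t)$ belongs to $C[0,T]$ (i.e. extends continuously to $[0,T]$), with norm $\|x\|_{C_{1-\gamma,\rho}}=\max_{t\in[0,T]}|(t^{\rho}/\rho)^{1-\gamma}x(t)|$; $C[0,T]$ carries the sup norm. Katugampola fractional integral of order $\sigma>0$: $({}_{\rho}I^{\sigma}_{0+}x)(t)=\frac{\rho^{1-\sigma}}{\Gamma(\sigma)}\int_0^t\frac{\tau^{\rho-1}x(\tau)}{(t^{\rho}-\tau^{\rho})^{1-\sigma}}\,d\tau$, $t>0$; ${}_{\rho}I^{0}_{0+}$ is the identity. Hilfer-Katugampola fractional derivative of order $\alpha$ and type $\beta$: ${}_{\rho}D^{\alpha,\beta}_{0+}x={}_{\rho}I^{\beta(1-\alpha)}_{0+}\big(t^{1-\rho}\tfrac{d}{dt}\big)\,{}_{\rho}I^{(1-\alpha)(1-\beta)}_{0+}x$. Note $1-\gamma=(1-\alpha)(1-\beta)$. The value ${}_{\rho}I^{1-\gamma}_{0+}x(t)|_{t=0}$ is understood as the limit as $t\to0^+$. A solution on $(0,\mu)$ is a function whose restriction to $(0,b]$ lies in $C_{1-\gamma,\rho}[0,b]$ for every $b\in(0,\mu)$, satisfying the equation on $(0,\mu)$ and the initial condition. The paper treats the problem through the corresponding Volterra equation $x(t)=\frac{x_0}{\Gamma(\gamma)}(t^{\rho}/\rho)^{\gamma-1}+\frac{\rho^{1-\alpha}}{\Gamma(\alpha)}\int_0^t\frac{\tau^{\rho-1}\varphi(\tau,x(\tau))}{(t^{\rho}-\tau^{\rho})^{1-\alpha}}d\tau$.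 Continuation: if $x$ and $\hat x$ are solutions of the initial value problem on $(0,\mu)$ and $(0,\hat\mu)$ respectively, with $\mu<\hat\mu$ and $x(t)=\hat x(t)$ for $t\in(0,\mu)$, then $\hat x$ is a continuation of $x$ (and $x$ can be continued to $(0,\hat\mu)$). A solution is non-continuable if it has no continuation.
   Formalization: A solution (for x and for its continuations) may satisfy the fractional differential equation classically or through the corresponding Volterra equation; with only classical solutions the claim fails for β>0, since a bounded solution may have no classical continuation. *)

(* Defs.v *)
From HB Require Import structures.
From mathcomp Require Import all_boot all_order all_algebra.
From mathcomp Require Import all_classical all_reals all_analysis.

Set Implicit Arguments.
Unset Strict Implicit.
Unset Printing Implicit Defensive.

Import Order.TTheory GRing.Theory Num.Theory.
Import numFieldNormedType.Exports.

Local Open Scope classical_set_scope.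
Local Open Scope ring_scope.

(* Functions on ]0, b] or ]0, mu[ are total functions R -> R of which only the
   values on that interval are ever used. *)

Definition Gamma (R : realType) (a : R) : R :=
  \int[lebesgue_measure]_(s in `]0, +oo[) (s `^ (a - 1) * expR (- s)).

Definition hk_gamma (R : realType) (alpha beta : R) : R :=
  alpha + beta * (1 - alpha).

(** Function spaces *)

(* y : ]0, b] -> R belongs to C[0, b], its value at 0 being its limit there *)
Definition in_C (R : realType) (b : R) (y : R -> R) : Prop :=
  exists2 z : R -> R, {within `[0, b], continuous z} &
    forall t : R, 0 < t <= b -> z t = y t.

(* For y in C[0, b], the maximum over [0, b] of the continuous extension of
   |y| is the supremum of |y| over ]0, b]. *)
Definition C_norm (R : realType) (b : R) (y : R -> R) : R :=
  sup [set `|y t| | t in `]0, b]].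

Definition weighted (R : realType) (rho gam : R) (x : R -> R) : R -> R :=
  fun t => (t `^ rho / rho) `^ (1 - gam) * x t.

Definition in_Cw (R : realType) (rho gam b : R) (x : R -> R) : Prop :=
  in_C b (weighted rho gam x).

Definition Cw_norm (R : realType) (rho gam b : R) (x : R -> R) : R :=
  C_norm b (weighted rho gam x).

(* M is a continuous bounded (bounded sets to bounded sets) map from
   C_{1-gam,rho}[0, b] into C[0, b] *)
Definition continuous_bounded_map (R : realType) (rho gam b : R)
    (M : (R -> R) -> (R -> R)) : Prop :=
  [/\ forall x, in_Cw rho gam b x -> in_C b (M x),
      forall x, in_Cw rho gam b x -> forall e : R, 0 < e ->
        exists2 d : R, 0 < d & forall y, in_Cw rho gam b y ->
          Cw_norm rho gam b (y \- x) < d -> C_norm b (M y \- M x) < e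
    & forall B : R, exists K : R, forall x, in_Cw rho gam b x ->
        Cw_norm rho gam b x <= B -> C_norm b (M x) <= K].

(** Katugampola integral and Hilfer-Katugampola derivative *)

Definition kat_integrand (R : realType) (rho sigma : R) (x : R -> R) (t : R) :
    R -> R :=
  fun tau => tau `^ (rho - 1) * x tau / (t `^ rho - tau `^ rho) `^ (1 - sigma).

Definition kat_integral (R : realType) (rho sigma : R) (x : R -> R) : R -> R :=
  fun t => if sigma == 0 then x t else
    rho `^ (1 - sigma) / Gamma sigma *
    \int[lebesgue_measure]_(tau in `]0, t[) kat_integrand rho sigma x t tau.

(* t ^ (1 - rho) d/dt *)
Definition rho_derivative (R : realType) (rho : R) (h : R -> R) : R -> R :=
  fun t => t `^ (1 - rho) * derive1 h t.

Definition hk_derivative (R : realType) (rho alpha beta : R) (x : R -> R) :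
    R -> R :=
  kat_integral rho (beta * (1 - alpha))
    (rho_derivative rho
      (kat_integral rho ((1 - alpha) * (1 - beta)) x)).

(* The derivative above is meaningful on ]0, mu[: the inner integral h is
   continuously differentiable there, and the outer integral applies to
   rho_derivative rho h, i.e. h' = t ^ (rho - 1) * rho_derivative rho h is
   integrable near 0. *)
Definition hk_derivable (R : realType) (rho alpha beta : R) (mu : \bar R)
    (x : R -> R) : Prop :=
  let h := kat_integral rho ((1 - alpha) * (1 - beta)) x in
  forall t : R, 0 < t -> (t%:E < mu)%E ->
    [/\ derivable h t 1, {for t, continuous (derive1 h)} &
        lebesgue_measure.-integrable `]0, t[ (EFin \o derive1 h)].

(** Solutions of the initial value problem *)

Definition hk_equation (R : realType) (rho alpha beta : R) (phi : R -> R -> R)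
    (mu : \bar R) (x : R -> R) : Prop :=
  hk_derivable rho alpha beta mu x /\
  forall t : R, 0 < t -> (t%:E < mu)%E ->
    hk_derivative rho alpha beta x t = phi t (x t).

(* Integrability is required separately, since the Lebesgue integral of a
   non-integrable function is a junk value. *)
Definition volterra_equation (R : realType) (rho alpha beta x0 : R)
    (phi : R -> R -> R) (mu : \bar R) (x : R -> R) : Prop :=
  forall t : R, 0 < t -> (t%:E < mu)%E ->
    lebesgue_measure.-integrable `]0, t[
      (EFin \o kat_integrand rho alpha (fun tau => phi tau (x tau)) t) /\
    x t = x0 / Gamma (hk_gamma alpha beta) *
            (t `^ rho / rho) `^ (hk_gamma alpha beta - 1) +
          rho `^ (1 - alpha) / Gamma alpha *
            \int[lebesgue_measure]_(tau in `]0, t[)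
              (tau `^ (rho - 1) * phi tau (x tau) /
               (t `^ rho - tau `^ rho) `^ (1 - alpha)).

(* The equation is understood classically or through the Volterra equation.
   The second reading cannot be dropped: a solution of the Volterra equation
   with merely continuous right-hand side need not have a differentiable inner
   integral, so that for beta > 0 a bounded solution on a bounded interval may
   have no classical continuation at all. *)
Definition is_solution (R : realType) (rho alpha beta x0 : R)
    (phi : R -> R -> R) (mu : \bar R) (x : R -> R) : Prop :=
  [/\ forall b : R, 0 < b -> (b%:E < mu)%E -> in_Cw rho (hk_gamma alpha beta) b x,
      hk_equation rho alpha beta phi mu x \/
        volterra_equation rho alpha beta x0 phi mu x
    & kat_integral rho (1 - hk_gamma alpha beta) x t @[t --> 0^'+] --> x0].

(* xh on ]0, muh[ is a continuation of x on ]0, mu[ *)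
Definition is_continuation (R : realType) (rho alpha beta x0 : R)
    (phi : R -> R -> R) (mu : \bar R) (x : R -> R)
    (muh : \bar R) (xh : R -> R) : Prop :=
  [/\ is_solution rho alpha beta x0 phi mu x,
      is_solution rho alpha beta x0 phi muh xh,
      (mu < muh)%E &
      forall t : R, 0 < t -> (t%:E < mu)%E -> x t = xh t].

Definition noncontinuable (R : realType) (rho alpha beta x0 : R)
    (phi : R -> R -> R) (mu : \bar R) (x : R -> R) : Prop :=
  ~ exists muh xh, is_continuation rho alpha beta x0 phi mu x muh xh.

(* The filter of t -> mu^- for mu in ]0, +oo]; mu = -oo never occurs. *)
Definition left_nbhs (R : realType) (mu : \bar R) : set_system R :=
  match mu with
  | r%:E => r^'-
  | +oo%E => +oo
  | -oo%E => -oo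
  end.

(* Main.v *)
Require Import Defs.
From HB Require Import structures.
From mathcomp Require Import all_boot all_order all_algebra.
From mathcomp Require Import all_classical all_reals all_analysis.
From mathcomp Require Import measurable_realfun ring lra.

Set Implicit Arguments.
Unset Strict Implicit.
Unset Printing Implicit Defensive.

Import Order.TTheory GRing.Theory Num.Theory.
Import numFieldNormedType.Exports.

Local Open Scope classical_set_scope.
Local Open Scope ring_scope.

(** Why the theorem holds.

If x has a continuation then the end point mu is finite and the continuation is
continuous at mu, so x is bounded near mu and the upper limit is finite; for
mu = +oo there is no continuation and the upper limit is infinite because
|Phi(t)| >= t. The content is the converse: a solution bounded near a finite mu
can be continued.

In the variable s = t^rho / rho the Katugampola integrals are Riemann-Liouville
integrals and t^(1-rho) d/dt is d/ds ([kat_rl], [is_derive_kat_inv]). A solution,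
classical or not, then satisfies
  X(s) = x0 / Gamma(gamma) s^(gamma-1) + I^alpha F (s),  F(s) = phi(t, x(t)),
with F integrable near 0. For a classical solution this is
[hk_equation_abel]: it rests on the semigroup law I^a I^b = I^(a+b)
([rl_rl], from Fubini's theorem and the relation [Gamma_beta_e] between Beta and
Gamma) and on the inversion of the Abel operator ([rl_inversion]).

Let X be bounded near the end point r. The memory term I^alpha of F cut off at r
is a continuous function beyond r ([abel_continuous]), and the remaining equation
on [r, r + d[ is solved by Picard iteration, the Lipschitz condition making the
integral operator a contraction when d is small ([volterra_extension]). Since
the glued right-hand side is locally bounded away from 0, the glued solution is
continuous across r, and it is the required continuation
([bounded_continuation]). *)

(** * Change of variables on open intervals *)

Section Substitution.
Context {R : realType}.
Notation mu := (@lebesgue_measure R).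
Local Open Scope ereal_scope.

Lemma continuous_near_eq (g f : R -> R) (x : R) :
  (\forall y \near x, f y = g y) ->
  {for x, continuous g} -> {for x, continuous f}.
Proof.
move=> fg cg; suff : f y @[y --> x] --> g x by rewrite -(nbhs_singleton fg).
by apply: cvg_trans cg; apply: near_eq_cvg; near=> y; apply/esym; near: y.
Unshelve. all: by end_near. Qed.

Lemma itv_open_continuous_measurable (a b : R) (f : R -> R) :
  (forall x, (a < x < b)%R -> {for x, continuous f}) ->
  measurable_fun `]a, b[ f.
Proof.
move=> cf; apply: open_continuous_measurable_fun; first exact: interval_open.
by move=> x; rewrite inE/= in_itv/=; exact: cf.
Qed.

(** The weights met below blow up at the ends of the interval, so that a change of
variables on a compact interval does not apply directly: it is applied on the
members of an exhausting sequence of segments, and the two sides pass to the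
limit by monotone convergence. *)
Lemma ge0_subst_increasing_bigcup (D E : set R) (u v : nat -> R) (p p' G : R -> R) :
  (forall n, u n < v n)%R ->
  {homo u : m n / (m <= n)%N >-> (n <= m)%R} ->
  {homo v : m n / (m <= n)%N >-> (m <= n)%R} ->
  open D -> D = \bigcup_n `[u n, v n]%classic ->
  open E -> E = \bigcup_n `[p (u n), p (v n)]%classic ->
  (forall x, D x -> is_derive x 1%R p (p' x)) ->
  (forall x, D x -> {for x, continuous p'}) ->
  (forall x y, D x -> D y -> x < y -> p x < p y)%R ->
  (forall y, E y -> {for y, continuous G}) ->
  (forall y, E y -> 0 <= G y)%R ->
  \int[mu]_(y in E) (G y)%:E = \int[mu]_(x in D) (G (p x) * p' x)%:E.
Proof.
move=> uv du dv oD DE oE EE dp cp' ip cG G0.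
have Dn n x : (u n <= x <= v n)%R -> D x.
  by move=> xn; rewrite DE; exists n => //=; rewrite in_itv.
have Du n : D (u n) by apply: (@Dn n); rewrite lexx ltW.
have Dv n : D (v n) by apply: (@Dn n); rewrite lexx ltW.
have En n y : (p (u n) <= y <= p (v n))%R -> E y.
  by move=> yn; rewrite EE; exists n => //=; rewrite in_itv.
have wp x y : D x -> D y -> (x <= y)%R -> (p x <= p y)%R.
  move=> Dx Dy; rewrite le_eqVlt => /predU1P[->//|xy]; exact/ltW/ip.
have pE x : D x -> E (p x).
  move=> Dx; move: (Dx); rewrite DE => -[n _ /=]; rewrite in_itv/= => /andP[ux xv].
  by apply: (@En n); rewrite !wp.
have cpp x : D x -> {for x, continuous p}.
  move=> Dx; apply: differentiable_continuous; apply/derivable1_diffP.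
  by have := dp _ Dx => -[].
have p'E x : D x -> p^`()%classic x = p' x.
  by move=> Dx; rewrite derive1E; exact: (@derive_val _ _ _ _ _ _ _ (dp _ Dx)).
have p'0 x : D x -> (0 <= p' x)%R.
  move=> Dx; rewrite -p'E//.
  apply: (@incr_derive1_ge0 _ p D); rewrite -?interior_id// ?(proj1 (interior_id _))//.
  - by move=> y; rewrite inE => /dp[].
  - by move=> y z; rewrite !inE; exact: ip.
have cC n : {within `[p (u n), p (v n)], continuous G}.
  apply: continuous_in_subspaceT => y; rewrite inE/= in_itv/= => yn.
  by apply: cG; exact: (@En n).
have nearD x : D x -> \forall y \near x, D y.
  by move=> Dx; apply: open_nbhs_nbhs.
have cderive x : D x -> {for x, continuous (p^`()%classic)}.
  move=> Dx; apply: (@continuous_near_eq p'); last exact: cp'.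
  by near=> y; rewrite p'E//; near: y; exact: nearD.
have H n : \int[mu]_(y in `[p (u n), p (v n)]) (G y)%:E =
    \int[mu]_(x in `[u n, v n]) (G (p x) * p' x)%:E.
  rewrite (@integration_by_substitution_increasing _ p); last first.
  - exact: cC.
  - split.
    + move=> x; rewrite in_itv/= => /andP[ax xb].
      by have [] := dp x (@Dn n x _); rewrite // !ltW.
    + exact/cvg_at_right_filter/cpp.
    + exact/cvg_at_left_filter/cpp.
  - apply/cvg_ex; exists (p^`()%classic (v n)).
    exact/cvg_at_left_filter/cderive.
  - apply/cvg_ex; exists (p^`()%classic (u n)).
    exact/cvg_at_right_filter/cderive.
  - move=> x; rewrite in_itv/= => /andP[ax xb].
    by apply/cderive/(@Dn n); rewrite !ltW.
  - move=> x y; rewrite !in_itv/= => /Dn Dx /Dn Dy; exact: ip.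
  - exact/ltW.
  apply: eq_integral => x; rewrite inE/= in_itv/= => /Dn Dx.
  by rewrite /= fctE/= p'E.
have mE : measurable E by exact: open_measurable.
have mD : measurable D by exact: open_measurable.
have mG : measurable_fun E G.
  apply: open_continuous_measurable_fun => //.
  by move=> y; rewrite inE; exact: cG.
have mGp : measurable_fun D (fun x => G (p x) * p' x)%R.
  apply: open_continuous_measurable_fun => //.
  move=> x; rewrite inE => Dx; apply: continuousM; last exact: cp'.
  by apply: continuous_comp; [exact: cpp|exact/cG/pE].
have cl : \int[mu]_(x in `[p (u n), p (v n)]) (G x)%:E @[n --> \oo] -->
    \int[mu]_(x in E) (G x)%:E.
  rewrite [X in \int[mu]_(x in X) (G x)%:E]EE.
  apply: ge0_nondecreasing_set_cvg_integral => //.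
  - move=> m n mn; apply/subsetPset => y /=; rewrite !in_itv/= => /andP[uy yv].
    apply/andP; split.
      by apply: le_trans uy; rewrite wp// du.
    by apply: (le_trans yv); rewrite wp// dv.
  - move=> n; apply/measurable_EFinP; apply: measurable_funS mG => //.
    by move=> y /=; rewrite in_itv/= => /En.
  - by move=> n y /=; rewrite in_itv/= lee_fin => /En; exact: G0.
have cr : \int[mu]_(x in `[u n, v n]) (G (p x) * p' x)%:E @[n --> \oo] -->
    \int[mu]_(x in D) (G (p x) * p' x)%:E.
  rewrite [X in \int[mu]_(x in X) (G (p x) * p' x)%:E]DE.
  apply: ge0_nondecreasing_set_cvg_integral => //.
  - move=> m n mn; apply/subsetPset => y /=; rewrite !in_itv/= => /andP[uy yv].
    apply/andP; split.
      by apply: le_trans uy; rewrite du.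
    by apply: (le_trans yv); rewrite dv.
  - move=> n; apply/measurable_EFinP; apply: measurable_funS mGp => //.
    by move=> y /=; rewrite in_itv/= => /Dn.
  - move=> n y /=; rewrite in_itv/= lee_fin => /Dn Dy.
    by rewrite mulr_ge0// ?G0 ?p'0//; exact: pE.
have cr' : \int[mu]_(x in `[p (u n), p (v n)]) (G x)%:E @[n --> \oo] -->
    \int[mu]_(x in D) (G (p x) * p' x)%:E.
  by under eq_fun do rewrite H.
by move/(cvg_lim (@ereal_hausdorff R)): cl => <-; exact: (cvg_lim (@ereal_hausdorff R) cr').
Unshelve. all: by end_near. Qed.

Lemma ge0_subst_increasing_oo (a b c d : R) (p p' G : R -> R) :
  (a < b)%R ->
  (forall x, a < x < b -> is_derive x 1 p (p' x))%R ->
  (forall x, a < x < b -> {for x, continuous p'})%R ->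
  (forall x, a < x < b -> 0 < p' x)%R ->
  (forall x, a < x < b -> c < p x < d)%R ->
  (forall y, c < y < d -> exists2 x, a < x < b & p x = y)%R ->
  (forall y, c < y < d -> {for y, continuous G})%R ->
  (forall y, c < y < d -> 0 <= G y)%R ->
  \int[mu]_(y in `]c, d[) (G y)%:E = \int[mu]_(x in `]a, b[) (G (p x) * p' x)%:E.
Proof.
move=> ab dp cp p0 pE Ep cG G0.
have ba0 : (0 < b - a)%R by rewrite subr_gt0.
(* n + 3 rather than n + 1 makes a + e n < b - e n for every n. *)
pose e (n : nat) := ((b - a) / n.+3%:R)%R.
have e0 n : (0 < e n)%R by rewrite divr_gt0.
have de m n : (m <= n)%N -> (e n <= e m)%R.
  by move=> mn; rewrite ler_pM2l// lef_pV2 ?posrE// ler_nat.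
have e3 n : (e n <= (b - a) / 3)%R by rewrite (de 0%N).
have ip : {in `]a, b[ &, {homo p : x y / (x < y)%R}}.
  apply: gtr0_derive1_lt_oo.
  - by move=> x xab; have [] := dp x xab.
  - move=> x xab; rewrite derive1E (@derive_val _ _ _ _ _ _ _ (dp x xab)); exact: p0.
  - move=> x xab; apply: differentiable_continuous; apply/derivable1_diffP.
    by have := dp x; rewrite inE in xab; case=> //; move: xab; rewrite /= in_itv.
have wp x y : (a < x < b)%R -> (a < y < b)%R -> (x <= y)%R -> (p x <= p y)%R.
  by move=> Dx Dy; rewrite le_eqVlt => /predU1P[->//|xy]; apply/ltW/ip; rewrite ?in_itv.
have DE : `]a, b[%classic = \bigcup_n `[(a + e n)%R, (b - e n)%R]%classic :> set R.
  apply/seteqP; split => x /=; last first.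
    move=> [n _] /=; rewrite !in_itv/= => /andP[ax xb].
    by rewrite (lt_le_trans _ ax) ?ltrDl// (le_lt_trans xb)// gtrDl oppr_lt0.
  rewrite in_itv/= => /andP[ax xb].
  near \oo%nat => n; exists n => //=; rewrite in_itv/=.
  have : (e n <= Num.min (x - a) (b - x))%R.
    rewrite /e ler_pdivrMr// mulrC -ler_pdivrMr; last first.
      by rewrite lt_min !subr_gt0 ax xb.
    apply: (@le_trans _ _ n%:R%R); last by rewrite ler_nat -addn3 leq_addr.
    by near: n; exact: nbhs_infty_ger.
  rewrite le_min => /andP[h1 h2]; apply/andP; split; lra.
have euv n : (a < a + e n < b /\ a < b - e n < b /\ a + e n < b - e n)%R.
  have := e0 n; have := e3 n; set z := e n => h1 h2.
  split; [|split]; lra.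
apply: (@ge0_subst_increasing_bigcup _ _ (fun n => a + e n)%R (fun n => b - e n)%R) => //.
- by move=> n; have [_ []] := euv n.
- by move=> m n mn; rewrite lerD2l de.
- by move=> m n mn; rewrite lerD2l lerN2 de.
- apply/seteqP; split => y /=.
    rewrite in_itv/= => /Ep[x xab <-].
    have : `]a, b[%classic x by rewrite /= in_itv.
    rewrite DE => -[n _] /=; rewrite in_itv/= => /andP[ax xb]; exists n => //=.
    have [h1 [h2 h3]] := euv n.
    by rewrite in_itv/= !wp.
  move=> [n _]/=; rewrite !in_itv/= => /andP[py yp].
  have [/pE/andP[h1 _] [/pE/andP[_ h2] h3]] := euv n.
  by rewrite (lt_le_trans h1)// (le_lt_trans yp).
Unshelve. all: by end_near. Qed.

(** The statement for integrands of any sign includes integrability on both sides,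
which follows from the nonnegative case applied to the absolute value. *)
Lemma subst_increasing_oo (a b c d : R) (p p' G : R -> R) :
  (a < b)%R ->
  (forall x, a < x < b -> is_derive x 1 p (p' x))%R ->
  (forall x, a < x < b -> {for x, continuous p'})%R ->
  (forall x, a < x < b -> 0 < p' x)%R ->
  (forall x, a < x < b -> c < p x < d)%R ->
  (forall y, c < y < d -> exists2 x, a < x < b & p x = y)%R ->
  (forall y, c < y < d -> {for y, continuous G})%R ->
  (mu.-integrable `]c, d[ (fun y => (G y)%:E) <->
   mu.-integrable `]a, b[ (fun x => (G (p x) * p' x)%:E)) /\
  \int[mu]_(y in `]c, d[) (G y)%:E = \int[mu]_(x in `]a, b[) (G (p x) * p' x)%:E.
Proof.
move=> ab dp cp p0 pE Ep cG.
have subst H := @ge0_subst_increasing_oo a b c d p p' H ab dp cp p0 pE Ep.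
have cGp x : (a < x < b)%R -> {for x, continuous (fun x => G (p x) * p' x)%R}.
  move=> xab; apply: continuousM; last exact: cp.
  apply: continuous_comp; last exact/cG/pE.
  by apply: differentiable_continuous; apply/derivable1_diffP; have [] := dp x xab.
split.
  have -> : mu.-integrable `]c, d[ (fun y => (G y)%:E) <->
      \int[mu]_(x in `]c, d[) `|(G x)%:E| < +oo.
    split=> [/integrableP[]//|Goo]; apply/integrableP; split => //.
    by apply/measurable_EFinP; apply: itv_open_continuous_measurable.
  have -> : mu.-integrable `]a, b[ (fun y => (G (p y) * p' y)%:E) <->
      \int[mu]_(x in `]a, b[) `|(G (p x) * p' x)%:E| < +oo.
    split=> [/integrableP[]//|Goo]; apply/integrableP; split => //.
    by apply/measurable_EFinP; apply: itv_open_continuous_measurable.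
  have -> // : \int[mu]_(x in `]c, d[) `|(G x)%:E| =
      \int[mu]_(x in `]a, b[) `|(G (p x) * p' x)%:E|.
  rewrite (subst (fun y => `|G y|)%R)//; last first.
    by move=> y /cG cGy; apply: continuous_comp => //; exact: norm_continuous.
  apply: eq_integral => x; rewrite inE/= in_itv/= => /p0 p'0.
  by rewrite normrM (gtr0_norm p'0).
rewrite [LHS]integralE [RHS]integralE; congr (_ - _).
- transitivity (\int[mu]_(x in `]c, d[) (Num.max (G x) 0)%:E).
    by apply: eq_integral => x _; rewrite funeposE EFin_max.
  rewrite subst.
  + apply: eq_integral => x; rewrite inE/= in_itv/= => /p0 p'0.
    by rewrite funeposE -EFin_max maxr_pMl ?mul0r// ltW.
  + by move=> y /cG cGy; apply: continuous_max => //; exact: cst_continuous.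
  + by move=> y _; rewrite le_max lexx orbT.
- transitivity (\int[mu]_(x in `]c, d[) (Num.max (- G x) 0)%:E).
    by apply: eq_integral => x _; rewrite funenegE EFin_max.
  rewrite subst.
  + apply: eq_integral => x; rewrite inE/= in_itv/= => /p0 p'0.
    by rewrite funenegE -EFinN -EFin_max maxr_pMl ?mul0r ?mulNr// ltW.
  + move=> y /cG cGy; apply: continuous_max; last exact: cst_continuous.
    exact: continuousN.
  + by move=> y _; rewrite le_max lexx orbT.
Qed.
End Substitution.

(** * Power kernels, Beta and Gamma integrals *)

Section Kernels.
Context {R : realType}.
Notation mu := (@lebesgue_measure R).
Implicit Types (a b s t u v x : R).

Lemma powR_continuous a x : 0 < x -> {for x, continuous (fun z : R => z `^ a)}.
Proof.
move=> x0; apply: differentiable_continuous; apply/derivable1_diffP.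
by have [] := is_derive1_powR a x0.
Qed.

Lemma powR_subl_continuous (c a z : R) : z < c ->
  {for z, continuous (fun x : R => (c - x) `^ a)}.
Proof.
move=> zc; apply: (@continuous_comp _ _ _ (fun x : R => c - x) (fun x : R => x `^ a)).
  by apply: continuousB; [exact: cst_continuous|exact: cvg_id].
by apply: powR_continuous; rewrite subr_gt0.
Qed.

Lemma powR_subr_continuous (c a z : R) : c < z ->
  {for z, continuous (fun x : R => (x - c) `^ a)}.
Proof.
move=> zc; apply: (@continuous_comp _ _ _ (fun x : R => x - c) (fun x : R => x `^ a)).
  by apply: continuousB; [exact: cvg_id|exact: cst_continuous].
by apply: powR_continuous; rewrite subr_gt0.
Qed.

Lemma powR_invK a x : a != 0 -> 0 <= x -> (x `^ a^-1) `^ a = x.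
Proof. by move=> a0 x0; rewrite -powRrM mulVf// powRr1. Qed.

(** The constant integrand turns the change of variables into a fundamental theorem
of calculus that tolerates a derivative unbounded at the end points. *)
Lemma integral_derive_oo (a b c d : R) (p p' : R -> R) : a < b -> c <= d ->
  (forall x, a < x < b -> is_derive x 1 p (p' x)) ->
  (forall x, a < x < b -> {for x, continuous p'}) ->
  (forall x, a < x < b -> 0 < p' x) ->
  (forall x, a < x < b -> c < p x < d) ->
  (forall y, c < y < d -> exists2 x, a < x < b & p x = y) ->
  (\int[mu]_(x in `]a, b[) (p' x)%:E = (d - c)%:E)%E.
Proof.
move=> ab cd dp cp p0 pE Ep.
have <- : (\int[mu]_(y in `]c, d[) (cst 1%:E) y = (d - c)%:E)%E.
  rewrite integral_cst//= mul1e lebesgue_measure_itv/= lte_fin.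
  move: cd; rewrite le_eqVlt => /predU1P[->|->]; last by rewrite EFinB.
  by rewrite ltxx subrr.
transitivity (\int[mu]_(x in `]a, b[) (cst 1 (p x) * p' x)%:E)%E.
  by apply: eq_integral => x _; rewrite mul1r.
apply/esym/(@ge0_subst_increasing_oo R a b c d p p' (cst 1)) => //.
by move=> y _; exact: cst_continuous.
Qed.

Lemma integral_kernel_left a s t : 0 < a -> s < t ->
  (\int[mu]_(u in `]s, t[) ((t - u) `^ (a - 1))%:E = ((t - s) `^ a / a)%:E)%E.
Proof.
move=> a0 st; have aN0 : a != 0 by rewrite gt_eqF.
have ts0 : 0 < t - s by rewrite subr_gt0.
(* the increasing primitive of the kernel, vanishing at its singular end *)
pose p u := - ((t - u) `^ a / a).
transitivity ((0 - - ((t - s) `^ a / a))%:E : \bar R); last by rewrite sub0r opprK.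
apply: (@integral_derive_oo _ _ _ _ p (fun u => (t - u) `^ (a - 1))); [by []|..].
- by rewrite oppr_le0 divr_ge0 ?powR_ge0// ltW.
- move=> u /andP[su ut].
  have tu0 : 0 < t - u by rewrite subr_gt0.
  have d1 : is_derive u 1 (fun u => t - u) (-1).
    have := is_deriveB (is_derive_cst t u 1) (is_derive_id u 1).
    by rewrite sub0r.
  have d2 := @is_derive1_comp R (@powR R ^~ a) (fun u => t - u) u _ _ (is_derive1_powR a tu0) d1.
  have -> : p = (- (a^-1)) \*: ((@powR R ^~ a) \o (fun u => t - u)).
    by apply/funext => z; rewrite /p/= /GRing.scale/= mulNr mulrC.
  by apply: is_derive_eq; rewrite /GRing.scale/= mulrN1 mulrNN mulrA mulVf// mul1r.
- move=> u /andP[su ut]; exact: powR_subl_continuous.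
- by move=> u /andP[su ut]; rewrite powR_gt0// subr_gt0.
- move=> u /andP[su ut]; rewrite /p ltrN2 oppr_lt0 divr_gt0 ?powR_gt0 ?subr_gt0// andbT.
  by rewrite ltr_pM2r ?invr_gt0// gt0_ltr_powR ?nnegrE ?subr_ge0 ?ltrD2l ?ltrN2// ltW.
- move=> y /andP[sy y0].
  have z0 : 0 < a * - y by rewrite mulr_gt0// oppr_gt0.
  have zs : a * - y < (t - s) `^ a by rewrite mulrC -ltr_pdivlMr// ltrNl.
  exists (t - (a * - y) `^ a^-1).
    rewrite ltrBrDl -ltrBrDr gtrDl oppr_lt0 powR_gt0// andbT.
    rewrite -[ltRHS](powR_invK (a := a^-1)) ?invr_eq0// ?ltW// invrK.
    by rewrite gt0_ltr_powR ?invr_gt0// nnegrE ?powR_ge0// ltW.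
  by rewrite /p subKr powR_invK ?(ltW z0)// mulrC mulrA mulVf// mul1r opprK.
Qed.

Lemma integral_kernel_right a s t : 0 < a -> s < t ->
  (\int[mu]_(u in `]s, t[) ((u - s) `^ (a - 1))%:E = ((t - s) `^ a / a)%:E)%E.
Proof.
move=> a0 st; have aN0 : a != 0 by rewrite gt_eqF.
have ts0 : 0 < t - s by rewrite subr_gt0.
pose p u := (u - s) `^ a / a.
transitivity (((t - s) `^ a / a - 0)%:E : \bar R); last by rewrite subr0.
apply: (@integral_derive_oo _ _ _ _ p (fun u => (u - s) `^ (a - 1))); [by []|..].
- by rewrite divr_ge0 ?powR_ge0// ltW.
- move=> u /andP[su ut].
  have us0 : 0 < u - s by rewrite subr_gt0.
  have d1 : is_derive u 1 (fun u => u - s) 1.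
    have := is_deriveB (is_derive_id u 1) (is_derive_cst s u 1).
    by rewrite subr0.
  have d2 := @is_derive1_comp R (@powR R ^~ a) (fun u => u - s) u _ _ (is_derive1_powR a us0) d1.
  have -> : p = a^-1 \*: ((@powR R ^~ a) \o (fun u => u - s)).
    by apply/funext => z; rewrite /p/= /GRing.scale/= mulrC.
  by apply: is_derive_eq; rewrite /GRing.scale/= mulr1 mulrA mulVf// mul1r.
- move=> u /andP[su ut]; exact: powR_subr_continuous.
- by move=> u /andP[su ut]; rewrite powR_gt0// subr_gt0.
- move=> u /andP[su ut]; rewrite /p divr_gt0 ?powR_gt0 ?subr_gt0//=.
  by rewrite ltr_pM2r ?invr_gt0// gt0_ltr_powR ?nnegrE ?subr_ge0 ?ltrD2r// ltW.
- move=> y /andP[y0 sy].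
  have z0 : 0 < a * y by rewrite mulr_gt0.
  have zs : a * y < (t - s) `^ a by rewrite mulrC -ltr_pdivlMr.
  exists (s + (a * y) `^ a^-1).
    rewrite ltrDl powR_gt0//= -ltrBrDl.
    rewrite -[ltRHS](powR_invK (a := a^-1)) ?invr_eq0// ?ltW// invrK.
    by rewrite gt0_ltr_powR ?invr_gt0// nnegrE ?powR_ge0// ltW.
  by rewrite /p addrAC subrr add0r powR_invK ?(ltW z0)// mulrC mulrA mulVf// mul1r.
Qed.

(** The Beta integral, in the extended reals until its finiteness is known. *)
Definition beta_e a b : \bar R :=
  (\int[mu]_(x in `]0%R, 1%R[) ((1 - x) `^ (a - 1) * x `^ (b - 1))%:E)%E.

(** The affine map of ]0, 1[ onto ]s, t[ shows that the convolution of two power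
kernels is a power kernel, up to the Beta integral. *)
Lemma integral_beta_kernel a b s t : s < t ->
  (\int[mu]_(v in `]s, t[) ((t - v) `^ (a - 1) * (v - s) `^ (b - 1))%:E =
   ((t - s) `^ (a + b - 1))%:E * beta_e a b)%E.
Proof.
move=> st; have ts0 : 0 < t - s by rewrite subr_gt0.
pose p x := s + (t - s) * x.
transitivity (\int[mu]_(x in `]0%R, 1%R[)
  ((t - p x) `^ (a - 1) * (p x - s) `^ (b - 1) * (t - s))%:E)%E.
  apply: (@ge0_subst_increasing_oo R 0 1 s t p (cst (t - s))
    (fun v => (t - v) `^ (a - 1) * (v - s) `^ (b - 1))); [exact: ltr01|..].
  - move=> x _; rewrite /p; apply: is_derive_eq.
    by rewrite /GRing.scale/= add0r mul1r mulr1.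
  - by move=> x _; exact: cst_continuous.
  - by [].
  - move=> x /andP[x0 x1]; rewrite /p ltrDl mulr_gt0//= -ltrBrDl.
    by rewrite gtr_pMr.
  - move=> y /andP[sy yt]; exists ((y - s) / (t - s)).
      by rewrite divr_gt0 ?subr_gt0//= ltr_pdivrMr// mul1r ltrD2r.
    by rewrite /p mulrCA mulfV ?gt_eqF// mulr1 addrC subrK.
  - by move=> y /andP[sy yt]; apply: continuousM; [exact: powR_subl_continuous|exact: powR_subr_continuous].
  - by move=> y _; rewrite mulr_ge0 ?powR_ge0.
rewrite /beta_e -ge0_integralZl_EFin//; first last.
- exact: powR_ge0.
- apply/measurable_EFinP; apply: itv_open_continuous_measurable => x /andP[x0 x1].
  by apply: continuousM; [exact: powR_subl_continuous|exact: powR_continuous].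
- by move=> x _; rewrite lee_fin mulr_ge0 ?powR_ge0.
apply: eq_integral => x; rewrite inE/= in_itv/= => /andP[x0 x1].
rewrite -EFinM; congr EFin.
have -> : t - p x = (t - s) * (1 - x) by rewrite /p; ring.
have -> : p x - s = (t - s) * x by rewrite /p; ring.
rewrite !powRM ?subr_ge0 ?(ltW x1) ?(ltW x0) ?(ltW st)//.
have -> : (t - s) `^ (a + b - 1) =
   (t - s) `^ (a - 1) * (t - s) `^ (b - 1) * (t - s).
  rewrite -[X in _ = _ * _ * X]powRr1 ?(ltW ts0)// -!powRD ?(gt_eqF ts0) ?implybT//.
  by congr (_ `^ _); ring.
by rewrite /=; ring.
Qed.

Lemma beta_e_ge0 a b : (0 <= beta_e a b)%E.
Proof.
by apply: integral_ge0 => x _; rewrite lee_fin mulr_ge0 ?powR_ge0.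
Qed.

(** Power kernel extended by 0 to the negative reals: with it, integrals over
moving intervals become convolutions on the whole line, ready for Fubini. *)
Definition ker a : R -> R := (fun x => x `^ (a - 1)) \_ `]0, +oo[.

Lemma kerE a x : 0 < x -> ker a x = x `^ (a - 1).
Proof. by move=> x0; rewrite /ker patchE mem_set//= in_itv/= x0. Qed.

Lemma ker_le0 a x : x <= 0 -> ker a x = 0.
Proof.
by move=> x0; rewrite /ker patchE memNset//= in_itv/= andbT; apply/negP; rewrite -leNgt.
Qed.

Lemma ker_ge0 a x : 0 <= ker a x.
Proof. by have [x0|x0] := lerP x 0; [rewrite ker_le0|rewrite kerE// powR_ge0]. Qed.

Lemma measurable_ker a : measurable_fun setT (ker a).
Proof. by apply/(measurable_restrictT _ (measurable_itv _)); apply: measurable_funTS; exact: measurable_powR. Qed.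

Lemma itvy_open_continuous_measurable a (f : R -> R) :
  (forall x, a < x -> {for x, continuous f}) -> measurable_fun `]a, +oo[ f.
Proof.
move=> cf; apply: open_continuous_measurable_fun; first exact: interval_open.
by move=> x; rewrite inE/= in_itv/= andbT; exact: cf.
Qed.

(** The Gamma integral as an extended real, for use with Tonelli's theorem before
it is known to be finite. *)
Definition Gamma_e a : \bar R :=
  (\int[mu]_(s in `]0%R, +oo[) (s `^ (a - 1) * expR (- s))%:E)%E.

Lemma continuous_expRN x : {for x, continuous (fun z : R => expR (- z))}.
Proof.
apply: (@continuous_comp _ _ _ (fun x : R => - x) expR); first exact: continuousN.
exact: continuous_expR.
Qed.

Lemma measurable_Gamma_integrand a :
  measurable_fun (`]0, +oo[%classic : set R) (fun s : R => s `^ (a - 1) * expR (- s)).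
Proof.
apply: itvy_open_continuous_measurable => x x0.
by apply: continuousM; [exact: powR_continuous|exact: continuous_expRN].
Qed.

Lemma integral_Gamma_shift a u :
  (\int[mu]_(v in `]u, +oo[) ((v - u) `^ (a - 1) * expR (- v))%:E =
   (expR (- u))%:E * Gamma_e a)%E.
Proof.
(* an exhaustion of ]0, +oo[ by segments *)
pose un (n : nat) := (n.+1%:R^-1 : R); pose vn (n : nat) := (n.+2%:R : R).
have un0 n : 0 < un n by rewrite invr_gt0.
have DE : `]0%R, +oo[%classic = \bigcup_n `[un n, vn n]%classic :> set R.
  apply/seteqP; split => x /=; rewrite !in_itv/= ?andbT.
    move=> x0; near \oo%nat => n; exists n => //=; rewrite in_itv/=; apply/andP; split.
      rewrite /un -[leRHS]invrK lef_pV2 ?posrE ?invr_gt0//.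
      apply: (@le_trans _ _ n%:R); last by rewrite ler_nat.
      by near: n; exact: nbhs_infty_ger.
    apply: (@le_trans _ _ n%:R); last by rewrite ler_nat -addn2 leq_addr.
    by near: n; exact: nbhs_infty_ger.
  by move=> [n _]/=; rewrite in_itv/= => /andP[+ _]; exact: lt_le_trans.
transitivity (\int[mu]_(w in `]0%R, +oo[)
  ((u + w - u) `^ (a - 1) * expR (- (u + w)) * 1)%:E)%E.
  apply: (@ge0_subst_increasing_bigcup R `]0, +oo[ `]u, +oo[ un vn (fun w => u + w) (cst 1)
    (fun v => (v - u) `^ (a - 1) * expR (- v))).
  - move=> n; rewrite /un /vn (@le_lt_trans _ _ 1) ?ltr1n//.
    by rewrite invf_le1// ler1n.
  - by move=> m n mn; rewrite lef_pV2 ?posrE// ler_nat.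
  - by move=> m n mn; rewrite ler_nat.
  - exact: interval_open.
  - by [].
  - exact: interval_open.
  - apply/seteqP; split => y /=; rewrite !in_itv/= ?andbT.
      move=> uy; have : `]0, +oo[%classic (y - u) by rewrite /= in_itv/= subr_gt0 uy.
      rewrite DE => -[n _]/=; rewrite in_itv/= => /andP[h1 h2].
      by exists n => //=; rewrite in_itv/= -lerBrDl h1 addrC -lerBlDr h2.
    move=> [n _]/=; rewrite in_itv/= => /andP[+ _]; apply: lt_le_trans.
    by rewrite ltrDl.
  - move=> x _.
    have := is_deriveD (is_derive_cst u x 1) (is_derive_id x 1).
    by rewrite add0r.
  - by move=> x _; exact: cst_continuous.
  - by move=> x y _ _; rewrite ltrD2l.
  - move=> y /=; rewrite in_itv/= andbT => uy.
    by apply: continuousM; [exact: powR_subr_continuous|exact: continuous_expRN].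
  - by move=> y _; rewrite mulr_ge0 ?powR_ge0 ?expR_ge0.
rewrite /Gamma_e -ge0_integralZl_EFin//; first last.
- by apply/measurable_EFinP; exact: measurable_Gamma_integrand.
- by move=> x _; rewrite lee_fin mulr_ge0 ?powR_ge0 ?expR_ge0.
apply: eq_integral => w _; rewrite -EFinM; congr EFin.
by rewrite [u + w]addrC addrK mulr1 opprD expRD; ring.
Unshelve. all: by end_near. Qed.

(** Both sides are the double integral of (v - u)^(a-1) u^(b-1) exp(-v) over
0 < u < v. Integrating in u first gives the Beta integral times v^(a+b-1);
integrating in v first translates into the Gamma integral at a. *)
Lemma Gamma_beta_e a b : 0 < a -> 0 < b ->
  (Gamma_e (a + b) * beta_e a b = Gamma_e a * Gamma_e b)%E.
Proof.
move=> a0 b0.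
pose f (z : R * R) : \bar R := (ker a (z.1 - z.2) * ker b z.2 * expR (- z.1))%:E.
have f0 z : (0 <= f z)%E by rewrite lee_fin !mulr_ge0 ?ker_ge0 ?expR_ge0.
have mf : measurable_fun setT f.
  apply/measurable_EFinP; apply: measurable_funM; first apply: measurable_funM.
  - apply: (measurableT_comp (measurable_ker a)); apply: measurable_funB.
      exact: measurable_fst.
    exact: measurable_snd.
  - exact: (measurableT_comp (measurable_ker b)).
  - apply: (measurableT_comp (@measurable_expR R)).
    by apply: measurableT_comp => //; exact: measurable_fst.
have := @fubini_tonelli _ _ _ _ R mu mu f mf f0.
have -> : (\int[mu]_v \int[mu]_u f (v, u) = Gamma_e (a + b) * beta_e a b)%E.
  rewrite muleC /Gamma_e -ge0_integralZl//; last 3 first.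
  - by apply/measurable_EFinP; exact: measurable_Gamma_integrand.
  - by move=> x _; rewrite lee_fin mulr_ge0 ?powR_ge0 ?expR_ge0.
  - exact: beta_e_ge0.
  rewrite [RHS]integral_mkcond; apply: eq_integral => v _; rewrite patchE.
  have [v0|v0] := ltrP 0 v; last first.
    rewrite memNset/= ?in_itv/= ?andbT; last by apply/negP; rewrite -leNgt.
    apply: integral0_eq => u _; rewrite /f/=.
    have [u0|u0] := lerP u 0; first by rewrite (ker_le0 b)// mulr0 mul0r.
    by rewrite (ker_le0 a) ?mul0r// subr_le0 (le_trans v0)// ltW.
  rewrite mem_set/= ?in_itv/= ?v0//.
  transitivity (\int[mu]_(u in `]0%R, v[)
     ((expR (- v))%:E * ((v - u) `^ (a - 1) * (u - 0) `^ (b - 1))%:E))%E.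
    rewrite [RHS]integral_mkcond; apply: eq_integral => u _; rewrite patchE /f/=.
    case: ifPn => [|/negP]; rewrite inE/= in_itv/=.
      move=> /andP[u0 uv]; rewrite !kerE ?subr_gt0// subr0 -EFinM; congr EFin; ring.
    move/negP; rewrite negb_and -!leNgt => /orP[u0|vu].
      by rewrite (ker_le0 b)// mulr0 mul0r.
    by rewrite (ker_le0 a) ?mul0r// subr_le0.
  rewrite ge0_integralZl_EFin//; first last.
  - apply/measurable_EFinP; apply: itv_open_continuous_measurable => u /andP[u0 uv].
    by apply: continuousM; [exact: powR_subl_continuous|exact: powR_subr_continuous].
  - by move=> u _; rewrite lee_fin mulr_ge0 ?powR_ge0.
  rewrite integral_beta_kernel// subr0 muleA -EFinM muleC; congr (_ * (_)%:E)%E.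
  by rewrite mulrC.
move=> ->.
rewrite [RHS]muleC.
have G0 : (0 <= Gamma_e a)%E.
  by apply: integral_ge0 => x _; rewrite lee_fin mulr_ge0 ?powR_ge0 ?expR_ge0.
rewrite muleC {2}/Gamma_e -ge0_integralZl//; last 2 first.
- by apply/measurable_EFinP; exact: measurable_Gamma_integrand.
- by move=> x _; rewrite lee_fin mulr_ge0 ?powR_ge0 ?expR_ge0.
rewrite [RHS]integral_mkcond; apply: eq_integral => u _; rewrite patchE.
have [u0|u0] := ltrP 0 u; last first.
  rewrite memNset/= ?in_itv/= ?andbT; last by apply/negP; rewrite -leNgt.
  by apply: integral0_eq => v _; rewrite /f/= (ker_le0 b)// mulr0 mul0r.
rewrite mem_set/= ?in_itv/= ?u0//.
transitivity (\int[mu]_(v in `]u, +oo[)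
   ((u `^ (b - 1))%:E * ((v - u) `^ (a - 1) * expR (- v))%:E))%E.
  rewrite [RHS]integral_mkcond; apply: eq_integral => v _; rewrite patchE /f/=.
  case: ifPn => [|/negP]; rewrite inE/= in_itv/= andbT.
    by move=> uv; rewrite !kerE ?subr_gt0// -EFinM; congr EFin; ring.
  by move/negP; rewrite -leNgt => vu; rewrite (ker_le0 a) ?mul0r// subr_le0.
rewrite ge0_integralZl_EFin//; first last.
- exact: powR_ge0.
- apply/measurable_EFinP; apply: itvy_open_continuous_measurable => v uv.
  by apply: continuousM; [exact: powR_subr_continuous|exact: continuous_expRN].
- by move=> v _; rewrite lee_fin mulr_ge0 ?powR_ge0 ?expR_ge0.
by rewrite integral_Gamma_shift muleA -EFinM muleC.
Qed.
End Kernels.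

(** * Values of the Gamma function *)

Section GammaFunction.
Context {R : realType}.
Notation mu := (@lebesgue_measure R).
Implicit Types (a b s t u v x : R).

Lemma Gamma_e1 : Gamma_e (1 : R) = 1%E.
Proof.
rewrite -(@integral_exponential_pdf R 1 ltr01) /Gamma_e.
rewrite [RHS](_ : _ = \int[mu]_(x in `[0%R, +oo[) (expR (- x))%:E)%E; last first.
  rewrite [RHS]integral_mkcond; apply: eq_integral => x _.
  rewrite /exponential_pdf !patchE; case: ifPn => // _.
  by rewrite mulN1r mul1r.
rewrite -integral_itv_obnd_cbnd; last first.
  apply/measurable_EFinP; apply: itvy_open_continuous_measurable => x _.
  exact: continuous_expRN.
by apply: eq_integral => x _; rewrite subrr powRr0 mul1r.
Qed.

Lemma Gamma_e_gt0 a : 0 < a -> (0 < Gamma_e a)%E.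
Proof.
move=> a0; have ic := @integral_kernel_right R a 0 1 a0 ltr01.
have cpos : (0 < (expR (-1))%:E * (((1 - 0 : R) `^ a) / a)%:E)%E.
  by rewrite -EFinM lte_fin mulr_gt0 ?expR_gt0// subr0 powR1 divr_gt0.
apply: (lt_le_trans cpos); rewrite -ic -ge0_integralZl_EFin//; last 2 first.
- by move=> x _; rewrite lee_fin powR_ge0.
- apply/measurable_EFinP; apply: itv_open_continuous_measurable => x /andP[x0 _].
  exact: powR_subr_continuous.
apply: (@le_trans _ _ (\int[mu]_(s in `]0%R, 1%R[) (s `^ (a - 1) * expR (- s))%:E)%E).
  apply: ge0_le_integral => //=.
  - by move=> x _; rewrite -EFinM lee_fin mulr_ge0 ?powR_ge0 ?expR_ge0.
  - apply/measurable_EFinP; apply: itv_open_continuous_measurable => x /andP[x0 _].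
    apply: continuousM; first exact: cst_continuous.
    exact: powR_subr_continuous.
  - apply/measurable_EFinP; apply: itv_open_continuous_measurable => x /andP[x0 _].
    by apply: continuousM; [exact: powR_continuous|exact: continuous_expRN].
  - move=> x; rewrite in_itv/= => /andP[x0 x1].
    by rewrite -EFinM lee_fin subr0 mulrC ler_wpM2l ?powR_ge0// ler_expR lerN2 ltW.
apply: ge0_subset_integral => //=.
- by apply/measurable_EFinP; exact: measurable_Gamma_integrand.
- by move=> x _; rewrite lee_fin mulr_ge0 ?powR_ge0 ?expR_ge0.
- by move=> x /=; rewrite !in_itv/= andbT => /andP[].
Qed.

(** For a <= 1 the integrand is at most s^(a-1) on ]0, 1[ and exp(-s) beyond. *)
Lemma Gamma_e_fin_le1 a : 0 < a -> a <= 1 -> (Gamma_e a < +oo)%E.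
Proof.
move=> a0 a1.
have E : `]0%R, +oo[%classic = `]0%R, 1%R[%classic `|` `[1%R, +oo[%classic :> set R.
  apply/seteqP; split => x /=; rewrite !in_itv/= ?andbT.
    by move=> x0; have [x1|x1] := ltrP x 1; [left; rewrite x0|right].
  by case=> [/andP[]//|]; exact: lt_le_trans.
have m1 : measurable_fun (`]0%R, 1%R[%classic : set R) (fun s : R => s `^ (a - 1) * expR (- s)).
  apply: itv_open_continuous_measurable => x /andP[x0 _].
  by apply: continuousM; [exact: powR_continuous|exact: continuous_expRN].
have m2 : measurable_fun (`[1%R, +oo[%classic : set R) (fun s : R => s `^ (a - 1) * expR (- s)).
  apply: measurable_funS (measurable_Gamma_integrand a) => //.
  by move=> x /=; rewrite !in_itv/= !andbT; exact: lt_le_trans.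
rewrite /Gamma_e E ge0_integral_setU//=; last 3 first.
- apply/measurable_EFinP; rewrite -E; exact: measurable_Gamma_integrand.
- by move=> x _; rewrite lee_fin mulr_ge0 ?powR_ge0 ?expR_ge0.
- apply/disj_setPS => x [] /=; rewrite !in_itv/= andbT => /andP[_ x1].
  by rewrite leNgt x1.
apply: lte_add_pinfty.
  apply: le_lt_trans (_ : ((1 - 0 : R) `^ a / a)%:E < +oo)%E; last exact: ltry.
  rewrite -(integral_kernel_right a0 ltr01); apply: ge0_le_integral => //=.
  - by move=> x _; rewrite lee_fin mulr_ge0 ?powR_ge0 ?expR_ge0.
  - exact/measurable_EFinP.
  - apply/measurable_EFinP; apply: itv_open_continuous_measurable => x /andP[x0 _].
    exact: powR_subr_continuous.
  - move=> x; rewrite in_itv/= => /andP[x0 x1].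
    by rewrite lee_fin subr0 ler_piMr ?powR_ge0// expR_le1 oppr_le0 ltW.
apply: le_lt_trans (_ : 1 < +oo)%E; last exact: ltry.
rewrite -Gamma_e1.
apply: (@le_trans _ _ (\int[mu]_(s in `[1%R, +oo[) (s `^ (1 - 1) * expR (- s))%:E)%E).
  apply: ge0_le_integral => //=.
  - by move=> x _; rewrite lee_fin mulr_ge0 ?powR_ge0 ?expR_ge0.
  - exact/measurable_EFinP.
  - apply/measurable_EFinP; apply: measurable_funS (measurable_Gamma_integrand 1) => //.
    by move=> x /=; rewrite !in_itv/= !andbT; exact: lt_le_trans.
  - move=> x; rewrite in_itv/= andbT => x1.
    by rewrite lee_fin ler_wpM2r ?expR_ge0// ler_powR// lerD2r.
apply: ge0_subset_integral => //=.
- by apply/measurable_EFinP; exact: measurable_Gamma_integrand.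
- by move=> x _; rewrite lee_fin mulr_ge0 ?powR_ge0 ?expR_ge0.
- by move=> x /=; rewrite !in_itv/= !andbT; exact: lt_le_trans.
Qed.

Lemma beta_e1 a : 0 < a -> beta_e a 1 = (a^-1)%:E.
Proof.
move=> a0; rewrite /beta_e.
transitivity (((1 - 0 : R) `^ a / a)%:E : \bar R); last by rewrite subr0 powR1 mul1r.
rewrite -(integral_kernel_left a0 ltr01).
by apply: eq_integral => x _; rewrite subrr powRr0 mulr1.
Qed.

(** The functional equation of Gamma is the Beta relation at b = 1. *)
Lemma Gamma_eS a : 0 < a -> (Gamma_e (a + 1) * (a^-1)%:E = Gamma_e a)%E.
Proof. by move=> a0; rewrite -beta_e1// Gamma_beta_e// Gamma_e1 mule1. Qed.

(** Finiteness propagates from ]0, 1] by the functional equation. *)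
Lemma Gamma_e_fin a : 0 < a -> Gamma_e a \is a fin_num.
Proof.
move=> a0; rewrite ge0_fin_numE ?(ltW (Gamma_e_gt0 a0))//.
have [n an] : exists n : nat, a <= n.+1%:R.
  exists (Num.truncn a); exact/ltW/truncnS_gt.
elim: n a a0 an => [|n IH] a a0 an; first exact: Gamma_e_fin_le1.
have [a1|a1] := lerP a 1; first exact: Gamma_e_fin_le1.
have b0 : 0 < a - 1 by rewrite subr_gt0.
have := IH _ b0; rewrite lerBlDr natr1 => /(_ an).
rewrite -(Gamma_eS b0) subrK => fin.
rewrite ltNge; apply/negP; rewrite leye_eq => /eqP E.
by move: fin; rewrite E gt0_mulye ?ltxx// lte_fin invr_gt0.
Qed.

Lemma GammaE a : 0 < a -> Gamma_e a = (Gamma a)%:E.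
Proof. by move=> a0; rewrite -[LHS]fineK ?Gamma_e_fin. Qed.

Lemma Gamma_gt0 a : 0 < a -> 0 < Gamma a.
Proof. by move=> a0; rewrite -lte_fin -GammaE// Gamma_e_gt0. Qed.

Lemma Gamma1 : Gamma 1 = 1 :> R.
Proof. by apply/EFin_inj; rewrite -GammaE// Gamma_e1. Qed.

Lemma beta_eE a b : 0 < a -> 0 < b ->
  beta_e a b = (Gamma a * Gamma b / Gamma (a + b))%:E.
Proof.
move=> a0 b0; have := Gamma_beta_e a0 b0; rewrite !GammaE ?addr_gt0//.
have G0 : 0 < Gamma (a + b) by rewrite Gamma_gt0// addr_gt0.
have := beta_e_ge0 a b; case: (beta_e a b) => [r _| |//].
  rewrite -!EFinM => -[<-]; congr EFin.
  by rewrite [X in X / _]mulrC mulfK// gt_eqF.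
by rewrite gt0_muley ?lte_fin// -EFinM.
Qed.
End GammaFunction.

(** * Abel integrals *)

Section AbelIntegral.
Context {R : realType}.
Notation mu := (@lebesgue_measure R).
Implicit Types (a b c s t u v x m e : R) (f g : R -> R).

Lemma le_powR_nonpos r x y : r <= 0 -> 0 < x -> x <= y -> y `^ r <= x `^ r.
Proof.
move=> r0 x0 xy; have y0 := lt_le_trans x0 xy.
rewrite -(opprK r) 2!(powRN _ (- r)) lef_pV2 ?posrE ?powR_gt0//.
by rewrite ge0_ler_powR ?nnegrE ?oppr_ge0 ?(ltW x0) ?(ltW y0).
Qed.

(** A bound on the power over [x, z] valid for both signs of the exponent. *)
Lemma powR_le_add r x y z : 0 < x -> x <= y -> y <= z ->
  y `^ r <= x `^ r + z `^ r.
Proof.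
move=> x0 xy yz; have y0 := lt_le_trans x0 xy; have z0 := lt_le_trans y0 yz.
have [r0|r0] := lerP r 0.
  by rewrite (le_trans (le_powR_nonpos r0 x0 xy))// lerDl powR_ge0.
by rewrite (le_trans (ge0_ler_powR (ltW r0) _ _ yz)) ?nnegrE ?ltW// ltrDr powR_gt0.
Qed.

Lemma le_Rintegrable (D : set (measurableTypeR R)) f g : measurable D ->
  measurable_fun D f -> (forall x, D x -> `|f x| <= g x) ->
  mu.-integrable D (EFin \o g) -> mu.-integrable D (EFin \o f).
Proof.
move=> mD mf fg; apply: le_integrable => //; first exact/measurable_EFinP.
by move=> x Dx; rewrite /= lee_fin (le_trans (fg x Dx))// ler_norm.
Qed.

Lemma eq_Rintegrable (D : set (measurableTypeR R)) f g : measurable D ->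
  (forall u, D u -> f u = g u) ->
  mu.-integrable D (EFin \o f) -> mu.-integrable D (EFin \o g).
Proof.
by move=> mD fg; apply: eq_integrable => // u; rewrite inE => Du; rewrite /= fg.
Qed.

Lemma Rintegrable_add (D : set (measurableTypeR R)) f g : measurable D ->
  mu.-integrable D (EFin \o f) -> mu.-integrable D (EFin \o g) ->
  mu.-integrable D (EFin \o (fun x => f x + g x)).
Proof. by move=> mD fi gi; apply: (eq_integrable mD _ _ _ (integrableD mD fi gi)) => x _; rewrite /= EFinD. Qed.

Lemma Rintegrable_sub (D : set (measurableTypeR R)) f g : measurable D ->
  mu.-integrable D (EFin \o f) -> mu.-integrable D (EFin \o g) ->
  mu.-integrable D (EFin \o (fun x => f x - g x)).
Proof. by move=> mD fi gi; apply: (eq_integrable mD _ _ _ (integrableB mD fi gi)) => x _; rewrite /= EFinB. Qed.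

Lemma Rintegrable_scale (D : set (measurableTypeR R)) c f : measurable D ->
  mu.-integrable D (EFin \o f) -> mu.-integrable D (EFin \o (fun x => c * f x)).
Proof. by move=> mD fi; apply: (eq_integrable mD _ _ _ (integrableZl mD c fi)) => x _; rewrite /= EFinM. Qed.

Lemma integrable_kernel_left a s t : 0 < a -> s < t ->
  mu.-integrable `]s, t[ (EFin \o (fun u => (t - u) `^ (a - 1))).
Proof.
move=> a0 st; apply/integrableP; split.
  apply/measurable_EFinP; apply: itv_open_continuous_measurable => x /andP[_ xt].
  exact: powR_subl_continuous.
under eq_integral do rewrite /= ger0_norm ?powR_ge0//.
by rewrite integral_kernel_left// ltry.
Qed.

Lemma Rintegral_kernel_left a s t : 0 < a -> s < t ->
  \int[mu]_(u in `]s, t[) (t - u) `^ (a - 1) = (t - s) `^ a / a.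
Proof. by move=> a0 st; rewrite /Rintegral integral_kernel_left. Qed.

Lemma integrable_kernel_right a s t : 0 < a -> s < t ->
  mu.-integrable `]s, t[ (EFin \o (fun u => (u - s) `^ (a - 1))).
Proof.
move=> a0 st; apply/integrableP; split.
  apply/measurable_EFinP; apply: itv_open_continuous_measurable => x /andP[xt _].
  exact: powR_subr_continuous.
under eq_integral do rewrite /= ger0_norm ?powR_ge0//.
by rewrite integral_kernel_right// ltry.
Qed.

Lemma Rintegral_kernel_right a s t : 0 < a -> s < t ->
  \int[mu]_(u in `]s, t[) (u - s) `^ (a - 1) = (t - s) `^ a / a.
Proof. by move=> a0 st; rewrite /Rintegral integral_kernel_right. Qed.

(** The Abel integral, without its normalisation by Gamma. *)
Definition abel a f s : R := \int[mu]_(u in `]0, s[) (f u * (s - u) `^ (a - 1)).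

(** The class on which all the operators act: integrable near 0 and bounded on the
rest of ]0, m[. Continuity is not required because the right-hand side of the
integral equation may jump where a solution is being prolonged. *)
Definition locint m f : Prop :=
  (forall s, 0 < s < m -> mu.-integrable `]0, s[ (EFin \o f)) /\
  (forall e s, 0 < e -> s < m ->
     exists M : R, forall u, e <= u <= s -> `|f u| <= M).

Lemma continuous_locint m f :
  (forall s, 0 < s < m -> {for s, continuous f}) ->
  (forall s, 0 < s < m -> mu.-integrable `]0, s[ (EFin \o f)) ->
  locint m f.
Proof.
move=> cf intf; split => // e s e0 sm.
have [es|se] := lerP e s; last first.
  exists 0 => u /andP[eu us]; have := le_trans eu us; by rewrite leNgt se.
have cfs : {within `[e, s], continuous (fun x => `|f x|)}.
  apply: continuous_in_subspaceT => x; rewrite inE/= in_itv/= => /andP[ex xs].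
  have : {for x, continuous f} by apply: cf; rewrite (lt_le_trans e0 ex) (le_lt_trans xs).
  by move=> cfx; apply: (@continuous_comp _ _ _ f) => //; exact: norm_continuous.
have [c _ cmax] := EVT_max es cfs.
by exists `|f c| => u ues; apply: cmax; rewrite in_itv.
Qed.

Lemma locint_norm m f : locint m f -> locint m (fun u => `|f u|).
Proof.
move=> [intf bf]; split => [s sm|e s e0 sm].
  exact: (integrable_norm (intf s sm)).
by have [M fM] := bf e s e0 sm; exists M => u us; rewrite normr_id fM.
Qed.

Lemma locint_measurable m f s : locint m f -> 0 < s < m ->
  measurable_fun `]0, s[ f.
Proof. by move=> [intf _] /intf /integrableP[/measurable_EFinP]. Qed.

(** On the left half of ]0, s[ the kernel is bounded; on the right half f is
bounded and the kernel is integrable. *)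
Lemma abel_integrable m a f s : 0 < a -> locint m f -> 0 < s < m ->
  mu.-integrable `]0, s[ (EFin \o (fun u => f u * (s - u) `^ (a - 1))).
Proof.
move=> a0 fm /[dup] sm /andP[s0 ltsm]; have [intf bf] := fm.
have h0 : 0 < s / 2 by rewrite divr_gt0.
have [M fM] := bf (s / 2) s h0 ltsm.
(* bounds the kernel on ]0, s / 2[ whatever the sign of a - 1 *)
pose C := (s / 2) `^ (a - 1) + s `^ (a - 1).
have C0 : 0 <= C by rewrite addr_ge0 ?powR_ge0.
pose g u := C * `|f u| + `|M| * (s - u) `^ (a - 1).
apply: (@le_Rintegrable _ _ g) => //.
- apply: measurable_funM; first exact: locint_measurable fm sm.
  apply: itv_open_continuous_measurable => x /andP[_ xs].
  exact: powR_subl_continuous.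
- move=> u; rewrite /= in_itv/= => /andP[u0 us].
  rewrite normrM (ger0_norm (powR_ge0 _ _)).
  have [us2|us2] := ltrP u (s / 2).
    rewrite (@le_trans _ _ (C * `|f u|))//; last by rewrite lerDl mulr_ge0// powR_ge0.
    rewrite mulrC ler_wpM2r// powR_le_add//; lra.
  rewrite (@le_trans _ _ (`|M| * (s - u) `^ (a - 1)))//; last by rewrite lerDr mulr_ge0.
  rewrite ler_wpM2r ?powR_ge0// (@le_trans _ _ M) ?ler_norm// fM//.
  by rewrite us2 ltW.
- apply: Rintegrable_add => //; apply: Rintegrable_scale => //.
    exact: (integrable_norm (intf s sm)).
  exact: integrable_kernel_left.
Qed.

(** When the end point moves from s' to s, the kernel decreases on ]e, s'[ and a
piece ]s', s[ is added. Both changes are integrated exactly, and their sum is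
at most twice the contribution of the added piece. *)
Lemma abel_tail_holder a e b M f s s' : 0 < a <= 1 -> e < s' -> s' < s -> s <= b ->
  measurable_fun `]e, b[ f -> (forall u, e < u < b -> `|f u| <= M) ->
  `|\int[mu]_(u in `]e, s[) (f u * (s - u) `^ (a - 1)) -
    \int[mu]_(u in `]e, s'[) (f u * (s' - u) `^ (a - 1))| <=
  2 * M / a * (s - s') `^ a.
Proof.
move=> /andP[a0 a1] es' s's sb mf fM.
have es := lt_trans es' s's.
have M0 : 0 <= M by rewrite (le_trans _ (fM ((e + s) / 2) _))//; lra.
have mf' c d : e <= c -> d <= b -> measurable_fun `]c, d[ f.
  move=> ec db; apply: measurable_funS mf => // x /=; rewrite !in_itv/= => /andP[cx xd].
  by rewrite (le_lt_trans ec cx) (lt_le_trans xd db).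
have mk r c : measurable_fun `]c, r[ (fun u => (r - u) `^ (a - 1)).
  by apply: itv_open_continuous_measurable => x /andP[_ xr]; exact: powR_subl_continuous.
have ik r c : e <= c -> c < r -> r <= b ->
    mu.-integrable `]c, r[ (EFin \o (fun u => f u * (r - u) `^ (a - 1))).
  move=> ec cr rb; apply: (@le_Rintegrable _ _ (fun u => M * (r - u) `^ (a - 1))) => //.
  - by apply: measurable_funM; [exact: mf'|exact: mk].
  - move=> u; rewrite /= in_itv/= => /andP[cu ur].
    rewrite normrM (ger0_norm (powR_ge0 _ _)) ler_wpM2r ?powR_ge0// fM//.
    by rewrite (le_lt_trans ec cu) (lt_le_trans ur rb).
  - by apply: Rintegrable_scale => //; exact: integrable_kernel_left.
have sub g : mu.-integrable `]e, s[ (EFin \o g) ->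
    mu.-integrable `]e, s'[ (EFin \o g) /\ mu.-integrable `]s', s[ (EFin \o g) /\
    \int[mu]_(u in `]e, s[) g u = \int[mu]_(u in `]e, s'[) g u + \int[mu]_(u in `]s', s[) g u.
  move=> ig.
  have i1 : mu.-integrable `]e, s'[ (EFin \o g).
    apply: integrableS ig => // x /=; rewrite !in_itv/= => /andP[-> xs].
    exact: lt_trans xs s's.
  split => //; split.
    apply: integrableS ig => // x /=; rewrite !in_itv/= => /andP[sx ->].
    by rewrite (lt_trans es' sx).
  have := Rintegral_itvB ig (_ : (BRight e <= BRight s')%O) (_ : (BRight s' <= BLeft s)%O).
  rewrite !bnd_simp => /(_ (ltW es') s's) <-.
  by rewrite (Rintegral_itv_bndo_bndc i1) addrC subrK.
have [i1 [i2 ->]] := sub _ (ik _ _ (lexx e) es sb).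
have i3 := ik _ _ (lexx e) es' (ltW (lt_le_trans s's sb)).
rewrite addrAC -RintegralB//.
have [k1 [k2 kE]] := sub _ (integrable_kernel_left a0 es).
have k3 := integrable_kernel_left a0 es'.
have kpos u : u < s' -> (s - u) `^ (a - 1) <= (s' - u) `^ (a - 1).
  move=> us; rewrite le_powR_nonpos ?subr_gt0// ?subr_le0//; lra.
have b1 : `|\int[mu]_(u in `]e, s'[) (f u * (s - u) `^ (a - 1) - f u * (s' - u) `^ (a - 1))|
    <= M * (\int[mu]_(u in `]e, s'[) (s' - u) `^ (a - 1) -
            \int[mu]_(u in `]e, s'[) (s - u) `^ (a - 1)).
  rewrite -RintegralB// -RintegralZl//; last exact: Rintegrable_sub.
  rewrite (le_trans (le_normr_Rintegral _ _))//; first exact: Rintegrable_sub.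
  apply: le_Rintegral => //.
  - by apply: integrable_norm; exact: Rintegrable_sub.
  - by apply: Rintegrable_scale => //; exact: Rintegrable_sub.
  - move=> u; rewrite /= in_itv/= => /andP[eu us].
    rewrite -mulrBr normrM distrC (@ger0_norm _ (_ - _)) ?subr_ge0 ?kpos//.
    rewrite ler_wpM2r ?subr_ge0 ?kpos// fM// eu/=.
    exact: lt_le_trans (lt_trans us s's) sb.
have b2 : `|\int[mu]_(u in `]s', s[) (f u * (s - u) `^ (a - 1))|
    <= M * \int[mu]_(u in `]s', s[) (s - u) `^ (a - 1).
  rewrite -RintegralZl// (le_trans (le_normr_Rintegral _ _))//.
  apply: le_Rintegral => //.
  - exact: (integrable_norm i2).
  - exact: Rintegrable_scale.
  - move=> u; rewrite /= in_itv/= => /andP[su us].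
    rewrite normrM (ger0_norm (powR_ge0 _ _)) ler_wpM2r ?powR_ge0// fM//.
    by rewrite (lt_trans es' su) (lt_le_trans us sb).
rewrite (le_trans (ler_normD _ _))// (le_trans (lerD b1 b2))//.
move: kE; rewrite !Rintegral_kernel_left// => kE.
rewrite -mulrDr (_ : 2 * M / a * (s - s') `^ a = M * (2 * ((s - s') `^ a / a))); last first.
  by ring.
rewrite ler_wpM2l//.
have : (s' - e) `^ a / a <= (s - e) `^ a / a.
  rewrite ler_wpM2r ?invr_ge0 ?(ltW a0)// ge0_ler_powR ?nnegrE ?subr_ge0 ?(ltW a0) ?(ltW es) ?(ltW es')//.
  by rewrite lerD2r ltW.
move: kE; set x := (\int[mu]_(_ in _) _); clearbody x.
move: ((s' - e) `^ a / a) ((s - e) `^ a / a) ((s - s') `^ a / a) => p q r.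
by clear => *; lra.
Qed.

(** The part of the integral near 0, where f is only integrable, has a smooth
kernel and is continuous by dominated convergence; the rest is Hölder. *)
Lemma abel_continuous m a f s : 0 < a <= 1 -> locint m f -> 0 < s < m ->
  {for s, continuous (abel a f)}.
Proof.
move=> a01 fm /[dup] sm /andP[s0 ltsm]; have [intf bf] := fm.
have /andP[a0 a1] := a01.
(* e separates the two parts of the integral, b leaves room to the right of s *)
pose e := s / 2; pose b := (s + m) / 2.
have e0 : 0 < e by rewrite divr_gt0.
have es : e < s by rewrite /e; lra.
have sb : s < b by rewrite /b; lra.
have bm : b < m by rewrite /b; lra.
have b0 : 0 < b by rewrite (lt_trans s0).
have [M0 fM0] := bf e b e0 bm; pose M : R := `|M0|.
have fM u : e < u < b -> `|f u| <= M.
  move=> /andP[eu ub]; rewrite (le_trans _ (ler_norm M0))// fM0//.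
  by rewrite !ltW.
have bbm : 0 < b < m by rewrite b0.
have ifb := intf b bbm.
have mfb := locint_measurable fm bbm.
pose A1 t := \int[mu]_(u in `]0, e]) (f u * (t - u) `^ (a - 1)).
pose A2 t := \int[mu]_(u in `]e, t[) (f u * (t - u) `^ (a - 1)).
have abelE t : e < t -> t < m -> abel a f t = A1 t + A2 t.
  move=> et tm; have tm0 : 0 < t < m by rewrite (lt_trans e0 et).
  have := Rintegral_itvB (abel_integrable a0 fm tm0) (_ : (BRight 0 <= BRight e)%O) (_ : (BRight e <= BLeft t)%O).
  rewrite !bnd_simp => /(_ (ltW e0) et).
  by move=> H; apply/eqP; rewrite addrC -subr_eq; apply/eqP.
have : {for s, continuous (fun t => A1 t + A2 t)}; last first.
  apply: continuous_near_eq; near=> t; apply: abelE.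
    by near: t; exact: lt_nbhsr.
  by near: t; exact: lt_nbhsl.
apply: continuousD.
  (* for t > c and u <= e the kernel stays away from its singularity *)
  pose c := 3 * s / 4.
  have ec : c - e = s / 4 by rewrite /c /e; lra.
  have iI : mu.-integrable `]0, e] (EFin \o f).
    apply: integrableS ifb => // x /=; rewrite !in_itv/= => /andP[-> xe].
    exact: le_lt_trans xe (lt_trans es sb).
  have mI : measurable_fun `]0, e] f by case/integrableP : iI => /measurable_EFinP.
  have mk (t : R) : c < t -> measurable_fun `]0, e] (fun u => f u * (t - u) `^ (a - 1)).
    move=> ct; apply: measurable_funM => //.
    apply: (@measurable_funS _ _ _ _ `]0, t[%classic) => //.
      move=> x /=; rewrite !in_itv/= => /andP[-> xe]; apply: (le_lt_trans xe); rewrite /e /c in ct *; lra.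
    by apply: itv_open_continuous_measurable => x /andP[_ xt]; exact: powR_subl_continuous.
  have gi : mu.-integrable `]0, e] (EFin \o (fun u => (s / 4) `^ (a - 1) * `|f u|)).
    by apply: Rintegrable_scale => //; exact: (integrable_norm iI).
  have bnd t u : c < t -> 0 < u <= e ->
      `|f u * (t - u) `^ (a - 1)| <= (s / 4) `^ (a - 1) * `|f u|.
    move=> ct /andP[u0 ue]; rewrite normrM (ger0_norm (powR_ge0 _ _)) mulrC ler_wpM2r//.
    rewrite le_powR_nonpos ?subr_le0 ?divr_gt0//; rewrite /c /e in ct ue *; lra.
  have cs : c < s < b by rewrite sb andbT /c; lra.
  apply: (@continuity_under_integral R _ _ mu
    (fun t u => f u * (t - u) `^ (a - 1)) `]0, e]%classic (measurable_itv _) c b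
    _ _ _ gi); last by rewrite inE/= in_itv.
  - move=> t /=; rewrite in_itv/= => /andP[ct tb].
    apply: (le_Rintegrable _ (mk t ct) _ gi) => // u /=; rewrite in_itv/=; exact: bnd.
  - apply: aeW => u /=; rewrite in_itv/= => /andP[u0 ue] t; rewrite inE/= in_itv/= => /andP[ct tb].
    apply: (@continuousM _ _ (cst (f u)) (fun t : R => (t - u) `^ (a - 1))).
      exact: cst_continuous.
    apply: powR_subr_continuous; apply: le_lt_trans ue _.
    by apply: lt_trans ct; rewrite -subr_gt0 ec divr_gt0.
  - move=> t /=; rewrite in_itv/= => /andP[ct tb]; apply: aeW => u /=; rewrite in_itv/=; exact: bnd.
have mfeb : measurable_fun `]e, b[ f.
  apply: measurable_funS mfb => // x /=; rewrite !in_itv/= => /andP[ex ->].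
  by rewrite (lt_trans e0 ex).
pose C : R := 2 * M / a.
have C0 : 0 <= C by rewrite divr_ge0 ?mulr_ge0 ?normr_ge0// ltW.
have hol t : e < t < b -> `|A2 s - A2 t| <= C * `|s - t| `^ a.
  move=> /andP[et tb]; have [st|ts|->] := ltgtP s t.
  - rewrite distrC [X in X `^ _]distrC (gtr0_norm (_ : 0 < t - s)) ?subr_gt0//.
    by apply: (@abel_tail_holder a e b M f t s) => //; exact: ltW.
  - rewrite (gtr0_norm (_ : 0 < s - t)) ?subr_gt0//.
    by apply: (@abel_tail_holder a e b M f s t) => //; exact: ltW.
  - by rewrite !subrr normr0 mulr_ge0// powR_ge0.
apply/cvgrPdist_lt => eps eps0.
have C1 : 0 < C + 1 by rewrite ltr_wpDl.
pose d := (eps / (C + 1)) `^ a^-1.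
have d0 : 0 < d by apply: powR_gt0; exact: divr_gt0.
near=> t.
have tI : e < t < b.
  by apply/andP; split; near: t; [exact: lt_nbhsr|exact: lt_nbhsl].
apply: (le_lt_trans (hol t tI)).
have td : `|s - t| < d by near: t; apply: cvgr_dist_lt => //; exact: cvg_id.
have : `|s - t| `^ a <= eps / (C + 1).
  rewrite -[leRHS](@powR_invK _ a) ?gt_eqF ?divr_ge0 ?(ltW eps0) ?(ltW C1)//.
  by rewrite ge0_ler_powR ?nnegrE ?powR_ge0 ?(ltW a0)// ltW.
rewrite ler_pdivlMr// => h.
have h2 : 0 <= `|s - t| `^ a by exact: powR_ge0.
have [->|h3] := eqVneq (`|s - t| `^ a) 0; first by rewrite mulr0.
by rewrite (lt_le_trans _ h)// mulrC ltr_pM2l ?ltrDl// lt0r h3.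
Unshelve. all: by end_near. Qed.
End AbelIntegral.

(** * The semigroup law *)

Section Semigroup.
Context {R : realType}.
Notation mu := (@lebesgue_measure R).
Implicit Types (a b c s t u v x m e : R) (f g : R -> R).

(** The Beta function, through its expression by Gamma. *)
Definition beta_fn a b : R := Gamma a * Gamma b / Gamma (a + b).

Lemma integral_ker_ker a b u s : 0 < a -> 0 < b -> u < s ->
  (\int[mu]_v (ker b (v - u) * ker a (s - v))%:E =
   (beta_fn a b * (s - u) `^ (a + b - 1))%:E)%E.
Proof.
move=> a0 b0 us; rewrite mulrC EFinM -beta_eE// -integral_beta_kernel//.
rewrite [RHS]integral_mkcond; apply: eq_integral => v _; rewrite patchE.
case: ifPn => [|/negP]; rewrite inE/= in_itv/=.
  by move=> /andP[uv vs]; rewrite !kerE ?subr_gt0// mulrC.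
move/negP; rewrite negb_and -!leNgt => /orP[vu|sv].
  by rewrite (ker_le0 b) ?mul0r// subr_le0.
by rewrite (ker_le0 a) ?mulr0// subr_le0.
Qed.

Lemma measurable_ker_ker a b u s :
  measurable_fun setT (fun v => ker b (v - u) * ker a (s - v)).
Proof.
apply: measurable_funM.
  by apply: (measurableT_comp (measurable_ker b)); exact: measurable_funB.
by apply: (measurableT_comp (measurable_ker a)); exact: measurable_funB.
Qed.

Lemma integral_ker_kerM a b c u s : 0 < a -> 0 < b -> u < s ->
  (\int[mu]_v (c * (ker b (v - u) * ker a (s - v)))%:E =
   (c * (beta_fn a b * (s - u) `^ (a + b - 1)))%:E)%E.
Proof.
move=> a0 b0 us; rewrite EFinM -integral_ker_ker// -integralZl//.
apply/integrableP; split; first by apply/measurable_EFinP; exact: measurable_ker_ker.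
under eq_integral do rewrite /= ger0_norm ?mulr_ge0 ?ker_ge0//.
by rewrite integral_ker_ker// ltry.
Qed.

Section Fubini.
Variables (m a b s : R) (f : R -> R).
Hypotheses (a0 : 0 < a) (b0 : 0 < b) (fm : locint m f) (sm : 0 < s < m).

Let f0 : R -> R := f \_ `]0, s[.
Let F (z : R * R) : \bar R := (f0 z.2 * (ker b (z.1 - z.2) * ker a (s - z.1)))%:E.

Let s0 : 0 < s. Proof. by case/andP: sm. Qed.
Let ab0 : 0 < a + b. Proof. exact: addr_gt0. Qed.

Let mF : measurable_fun (setT : set (measurableTypeR R * measurableTypeR R)) F.
Proof.
apply/measurable_EFinP; apply: measurable_funM; last apply: measurable_funM.
- apply: (@measurableT_comp _ _ _ _ _ _ f0); last exact: measurable_snd.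
  by apply/(measurable_restrictT _ (measurable_itv _)); exact: locint_measurable fm sm.
- apply: (measurableT_comp (measurable_ker b)); apply: measurable_funB.
    exact: measurable_fst.
  exact: measurable_snd.
- apply: (measurableT_comp (measurable_ker a)); exact: measurable_funB.
Qed.

Let inner_v (g : R -> R) : (\int[mu]_u \int[mu]_v
    ((g \_ `]0, s[) u * (ker b (v - u) * ker a (s - v)))%:E =
  \int[mu]_(u in `]0%R, s[) (g u * (beta_fn a b * (s - u) `^ (a + b - 1)))%:E)%E.
Proof.
rewrite [RHS]integral_mkcond; apply: eq_integral => u _; rewrite !patchE.
case: ifPn => [|_].
  by rewrite inE/= in_itv/= => /andP[u0 us]; rewrite integral_ker_kerM.
by apply: integral0_eq => v _; rewrite mul0r.
Qed.

Let intF : (mu \x mu)%E.-integrable setT F.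
Proof.
apply/(integrable21ltyP _ _ mF).
under eq_integral.
  move=> u _; under eq_integral.
    move=> v _; rewrite /F /= normrM [`|_ * ker a _|]ger0_norm ?mulr_ge0 ?ker_ge0//.
    have -> : `|f0 u| = ((fun u => `|f u|) \_ `]0, s[) u.
      by rewrite /f0 !patchE; case: ifPn => // _; rewrite normr0.
    over.
  over.
rewrite inner_v.
have ai := abel_integrable ab0 (locint_norm fm) sm.
have ai2 := Rintegrable_scale (beta_fn a b) (measurable_itv _) ai.
under eq_integral do rewrite mulrCA.
exact: (integrable_lty _ ai2).
Qed.

Let inner_u v : (\int[mu]_u F (v, u) =
  ((fun v => (abel b f v * (s - v) `^ (a - 1))%:E) \_ `]0%R, s[) v)%E.
Proof.
rewrite patchE; case: ifPn => [|/negP]; rewrite inE/= in_itv/=.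
  move=> /andP[v0 vs].
  have vm : 0 < v < m by rewrite v0 (lt_trans vs)//; case/andP: sm.
  have ai := abel_integrable b0 fm vm.
  rewrite /abel mulrC -RintegralZl// /Rintegral fineK; last first.
    by apply: integrable_fin_num => //; exact: Rintegrable_scale.
  rewrite [RHS]integral_mkcond; apply: eq_integral => u _; rewrite patchE /F/= /f0 patchE.
  case: ifPn => [|/negP]; rewrite inE/= in_itv/=.
    move=> /andP[u0 us]; case: ifPn => [|/negP]; rewrite inE/= in_itv/=.
      by move=> /andP[_ uv]; rewrite !kerE ?subr_gt0//; congr EFin; ring.
    move/negP; rewrite u0/= -leNgt => vu.
    by rewrite (ker_le0 b) ?mul0r ?mulr0// subr_le0.
  move/negP => us; rewrite mul0r; case: ifPn => //; rewrite inE/= in_itv/= => /andP[u0 uv].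
  by rewrite u0 (lt_trans uv vs) in us.
move/negP; rewrite negb_and -!leNgt => vs.
apply: integral0_eq => u _; rewrite /F/= /f0 patchE.
case: ifPn => [|/negP]; rewrite inE/= in_itv/=; last by rewrite mul0r.
move=> /andP[u0 us]; case/orP: vs => [v0|sv].
  by rewrite (ker_le0 b) ?mul0r ?mulr0// subr_le0 (le_trans v0)// ltW.
by rewrite (ker_le0 a) ?mulr0// subr_le0.
Qed.

(** One of the two by-products of Fubini's theorem for
f(u) (v - u)^(b-1) (s - v)^(a-1) on 0 < u < v < s, whose absolute integrability
is seen by integrating in v first. *)
Lemma abel_abel_integrable :
  mu.-integrable `]0, s[ (EFin \o (fun v => abel b f v * (s - v) `^ (a - 1))).
Proof.
have := integrable_fubini_F intF.
rewrite [fubini_F _ _](_ : _ = (fun v => (abel b f v * (s - v) `^ (a - 1))%:E) \_ `]0%R, s[)%E.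
  by move=> H; apply/integrable_mkcond.
by apply/funext => v; rewrite /fubini_F inner_u.
Qed.

(** The semigroup law, the other by-product: integration in v first produces the
kernel (s - u)^(a+b-1). *)
Lemma abel_abel : abel a (abel b f) s = beta_fn a b * abel (a + b) f s.
Proof.
have Ev : (\int[mu]_v \int[mu]_u F (v, u) =
    \int[mu]_(v in `]0%R, s[) (abel b f v * (s - v) `^ (a - 1))%:E)%E.
  by rewrite [RHS]integral_mkcond; apply: eq_integral => v _; exact: inner_u.
have E : (\int[mu]_v \int[mu]_u F (v, u) = \int[mu]_u \int[mu]_v F (v, u))%E.
  exact: Fubini intF.
have ai := abel_integrable ab0 fm sm.
rewrite [RHS](_ : _ = \int[mu]_(u in `]0, s[)
   (beta_fn a b * (f u * (s - u) `^ (a + b - 1)))); last by rewrite RintegralZl.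
rewrite {1}/abel /Rintegral -Ev E (inner_v f).
by congr fine; apply: eq_integral => u _; congr EFin; ring.
Qed.
End Fubini.

Lemma abel_locint m a f : 0 < a <= 1 -> locint m f -> locint m (abel a f).
Proof.
move=> a01 fm; have /andP[a0 a1] := a01; apply: continuous_locint => s sm.
  exact: abel_continuous fm sm.
have := abel_abel_integrable ltr01 a0 fm sm; congr (integrable _ _ _).
by apply/funext => v /=; rewrite subrr powRr0 mulr1.
Qed.
End Semigroup.

(** * Riemann-Liouville integrals and their inversion *)

Section RiemannLiouville.
Context {R : realType}.
Notation mu := (@lebesgue_measure R).
Implicit Types (a b c s t u v m e : R) (f g X Y H D : R -> R).

Lemma locintD m f g : locint m f -> locint m g -> locint m (fun u => f u + g u).
Proof.
move=> [fi fb] [gi gb]; split=> [s sm|e s e0 sm].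
  by apply: Rintegrable_add => //; [exact: fi|exact: gi].
have [M fM] := fb e s e0 sm; have [N gN] := gb e s e0 sm.
exists (M + N) => u us; rewrite (le_trans (ler_normD _ _))// lerD ?fM ?gN//.
Qed.

Lemma locintZ m c f : locint m f -> locint m (fun u => c * f u).
Proof.
move=> [fi fb]; split=> [s sm|e s e0 sm].
  by apply: Rintegrable_scale => //; exact: fi.
have [M fM] := fb e s e0 sm; exists (`|c| * M) => u us.
by rewrite normrM ler_wpM2l// fM.
Qed.

Lemma locint_powR m a : 0 < a -> locint m (fun u => u `^ (a - 1)).
Proof.
move=> a0; apply: continuous_locint => s /andP[s0 sm]; first exact: powR_continuous.
have := integrable_kernel_right a0 s0; congr (integrable _ _ _).
by apply/funext => v /=; rewrite subr0.
Qed.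

Lemma locint_cst m c : locint m (cst c).
Proof.
apply: continuous_locint => s /andP[s0 sm]; first exact: cst_continuous.
have := Rintegrable_scale c (measurable_itv _) (integrable_kernel_right ltr01 s0).
by congr (integrable _ _ _); apply/funext => v /=; rewrite subrr powRr0 mulr1.
Qed.

(** The Riemann-Liouville integral; the order 0 is the identity by convention, as
for the Katugampola integral. *)
Definition rl a f s : R := if a == 0 then f s else (Gamma a)^-1 * abel a f s.

Lemma eq_abel a f g s : (forall u, 0 < u < s -> f u = g u) ->
  abel a f s = abel a g s.
Proof.
move=> fg; apply: eq_Rintegral => u; rewrite inE/= in_itv/= => us.
by rewrite fg.
Qed.

Lemma rl_gt0 a f s : 0 < a -> rl a f s = (Gamma a)^-1 * abel a f s.
Proof. by move=> a0; rewrite /rl gt_eqF. Qed.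

Lemma rl0 f : rl 0 f = f.
Proof. by apply/funext => s; rewrite /rl eqxx. Qed.

Lemma eq_rl a f g s : 0 < s -> (forall u, 0 < u <= s -> f u = g u) ->
  rl a f s = rl a g s.
Proof.
move=> s0 fg; rewrite /rl; case: eqP => _; first by rewrite fg// s0 lexx.
by congr (_ * _); apply: eq_abel => u /andP[u0 us]; rewrite fg// u0 ltW.
Qed.

Lemma abelD m a f g s : 0 < a -> locint m f -> locint m g -> 0 < s < m ->
  abel a (fun u => f u + g u) s = abel a f s + abel a g s.
Proof.
move=> a0 fm gm sm; rewrite /abel -RintegralD//; last 2 first.
- exact: abel_integrable fm sm.
- exact: abel_integrable gm sm.
by apply: eq_Rintegral => u _; rewrite mulrDl.
Qed.

Lemma abelZ m a c f s : 0 < a -> locint m f -> 0 < s < m ->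
  abel a (fun u => c * f u) s = c * abel a f s.
Proof.
move=> a0 fm sm; rewrite /abel -RintegralZl//; last exact: abel_integrable fm sm.
by apply: eq_Rintegral => u _; rewrite mulrA.
Qed.

Lemma rlD m a f g s : 0 <= a -> locint m f -> locint m g -> 0 < s < m ->
  rl a (fun u => f u + g u) s = rl a f s + rl a g s.
Proof.
rewrite /rl le_eqVlt eq_sym => /predU1P[->|a0] fm gm sm; first by rewrite eqxx.
by rewrite gt_eqF// (abelD a0 fm gm sm) mulrDr.
Qed.

Lemma rlZ m a c f s : 0 <= a -> locint m f -> 0 < s < m ->
  rl a (fun u => c * f u) s = c * rl a f s.
Proof.
rewrite /rl le_eqVlt eq_sym => /predU1P[->|a0] fm sm; first by rewrite eqxx.
by rewrite gt_eqF// (abelZ c a0 fm sm) mulrCA.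
Qed.

Lemma rl_locint m a f : 0 <= a <= 1 -> locint m f -> locint m (rl a f).
Proof.
rewrite le_eqVlt => /andP[/predU1P[<- _|a0 a1]] fm.
  by rewrite (_ : rl 0 f = f)//; apply/funext => s; rewrite /rl eqxx.
rewrite (_ : rl a f = (fun s => (Gamma a)^-1 * abel a f s)).
  by apply/locintZ/abel_locint => //; rewrite a0.
by apply/funext => s; rewrite /rl gt_eqF.
Qed.

Lemma rl_continuous m a f s : 0 < a <= 1 -> locint m f -> 0 < s < m ->
  {for s, continuous (rl a f)}.
Proof.
move=> a01 fm sm; have /andP[a0 a1] := a01.
rewrite (_ : rl a f = (fun s => (Gamma a)^-1 * abel a f s)).
  apply: (@continuousM _ _ (cst (Gamma a)^-1) (abel a f)).
    exact: cst_continuous.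
  exact: abel_continuous fm sm.
by apply/funext => u; rewrite /rl gt_eqF.
Qed.

Lemma rl_rl m a b f s : 0 <= a -> 0 <= b <= 1 -> locint m f -> 0 < s < m ->
  rl a (rl b f) s = rl (a + b) f s.
Proof.
move=> a0 /andP[b0 b1] fm sm.
have [->|bN0] := eqVneq b 0; first by rewrite addr0 rl0.
have {}b0 : 0 < b by rewrite lt0r bN0.
have [->|aN0] := eqVneq a 0; first by rewrite add0r rl0.
have {}a0 : 0 < a by rewrite lt0r aN0.
have ab0 := addr_gt0 a0 b0.
have bm : locint m (abel b f) by apply: abel_locint => //; rewrite b0.
rewrite (_ : rl b f = (fun s => (Gamma b)^-1 * abel b f s)); last first.
  by apply/funext => u; rewrite rl_gt0.
rewrite (rl_gt0 _ _ a0) (rl_gt0 _ _ ab0).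
rewrite (abelZ (Gamma b)^-1 a0 bm sm) (abel_abel a0 b0 fm sm) /beta_fn.
move: (abel _ _ _) (Gamma_gt0 a0) (Gamma_gt0 b0) (Gamma_gt0 ab0).
move: (Gamma a) (Gamma b) (Gamma (a + b)) => ga gb gab x *.
by field; rewrite !gt_eqF.
Qed.

Lemma rl1 f s : rl 1 f s = \int[mu]_(u in `]0, s[) f u.
Proof.
rewrite /rl oner_eq0 Gamma1 invr1 mul1r; apply: eq_Rintegral => u _.
by rewrite subrr powRr0 mulr1.
Qed.

Lemma integrable_itv_bndoo s t f : mu.-integrable `]s, t[ (EFin \o f) ->
  mu.-integrable `[s, t] (EFin \o f).
Proof.
move=> /integrableP[/measurable_EFinP mf fi]; apply/integrableP; split.
  by apply/measurable_EFinP; apply: measurable_fun_itv_cc mf.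
by rewrite integral_itv_bndoo//; apply/measurableT_comp => //; exact/measurable_EFinP.
Qed.

Lemma Rintegral_itv_cc_oo s t f : mu.-integrable `]s, t[ (EFin \o f) ->
  \int[mu]_(u in `[s, t]) f u = \int[mu]_(u in `]s, t[) f u.
Proof.
by move=> /integrableP[mf _]; rewrite /Rintegral integral_itv_bndoo.
Qed.

Section Primitive.
Variables (m : R) (f : R -> R).
Hypotheses (cf : forall s, 0 < s < m -> {for s, continuous f})
  (fi : forall s, 0 < s < m -> mu.-integrable `]0, s[ (EFin \o f)).

Let P s := \int[mu]_(u in `[0, s]) f u.

Lemma primitiveE s : 0 < s < m -> P s = \int[mu]_(u in `]0, s[) f u.
Proof. by move=> /fi; exact: Rintegral_itv_cc_oo. Qed.

Lemma is_derive_primitive s : 0 < s < m -> is_derive s 1 P (f s).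
Proof.
move=> /[dup] sm /andP[s0 ltsm]; pose b := (s + m) / 2.
have sb : s < b by rewrite /b; lra.
have bm : 0 < b < m by rewrite (lt_trans s0 sb) /b; lra.
have := continuous_FTC1_closed sb (integrable_itv_bndoo (fi bm)) s0 (cf sm).
rewrite -/P => -[dP <-]; rewrite derive1E; exact: derivableP.
Qed.

Lemma primitive_cvg0 : 0 < m -> P s @[s --> 0^'+] --> (0 : R).
Proof.
move=> m0; have hm : 0 < m / 2 < m by lra.
have h0 : 0 < m / 2 by lra.
apply: cvg_at_right_filter.
exact: (parameterized_integral_cvg_left h0 (integrable_itv_bndoo (fi hm))).
Qed.
End Primitive.

(** H minus the primitive of D is constant on ]0, m[, and its value is read off at
the limit 0. *)
Lemma integral_derivative_oo m (x0 : R) H D :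
  (forall s, 0 < s < m -> is_derive s 1 H (D s)) ->
  (forall s, 0 < s < m -> {for s, continuous D}) ->
  (forall s, 0 < s < m -> mu.-integrable `]0, s[ (EFin \o D)) ->
  H s @[s --> 0^'+] --> x0 ->
  forall s, 0 < s < m -> H s = x0 + \int[mu]_(u in `]0, s[) D u.
Proof.
move=> dH cD iD H0 s /[dup] sm /andP[s0 ltsm].
pose P s := \int[mu]_(u in `[0, s]) D u.
pose K s := H s - P s.
have dK u : 0 < u < m -> is_derive u 1 K 0.
  move=> um; rewrite -(subrr (D u)).
  exact: (is_deriveB (dH u um) (is_derive_primitive cD iD um)).
have dK' u : u \in `]0, m[ -> derivable K u 1.
  by rewrite in_itv => /dK[].
have K'0 u : u \in `]0, m[ -> K^`()%classic u = 0.
  rewrite in_itv => um; rewrite derive1E; have h := dK u um; exact: derive_val.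
have cK : {in (`]0, m[%classic : set R), continuous K}.
  move=> u; rewrite inE /= => um.
  by apply: differentiable_continuous; apply/derivable1_diffP; exact: dK'.
have Kcst u v : 0 < u -> u <= v -> v < m -> K u = K v.
  move=> u0 uv vm; apply/eqP; rewrite eq_le; apply/andP; split.
    apply: (ger0_derive1_le_oo dK' _ cK) => //.
    - by move=> z /K'0 ->.
    - by rewrite in_itv/= u0 (le_lt_trans uv).
    - by rewrite in_itv/= vm (lt_le_trans u0).
  apply: (ler0_derive1_le_oo dK' _ cK) => //.
  - by move=> z /K'0 ->.
  - by rewrite in_itv/= vm (lt_le_trans u0).
  - by rewrite in_itv/= u0 (le_lt_trans uv).
have lim1 : K e @[e --> 0^'+] --> x0 - 0.
  by apply: cvgB => //; apply: (primitive_cvg0 iD); exact: lt_trans ltsm.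
have lim2 : K e @[e --> 0^'+] --> K s.
  apply: (@cvg_trans _ ((fun=> K s) e @[e --> 0^'+])); last exact: cvg_cst.
  apply: near_eq_cvg; near=> e; apply/esym/Kcst => //.
  by near: e; exact: nbhs_right_le.
have := cvg_unique (@Rhausdorff R) lim1 lim2.
by rewrite subr0 /K /P (primitiveE iD)// => ->; rewrite subrK.
Unshelve. all: by end_near. Qed.

(** Equal primitives have equal derivatives. *)
Lemma integral_inj_continuous m X Y :
  (forall s, 0 < s < m -> {for s, continuous X}) ->
  (forall s, 0 < s < m -> {for s, continuous Y}) ->
  (forall s, 0 < s < m -> mu.-integrable `]0, s[ (EFin \o X)) ->
  (forall s, 0 < s < m -> mu.-integrable `]0, s[ (EFin \o Y)) ->
  (forall s, 0 < s < m -> \int[mu]_(u in `]0, s[) X u = \int[mu]_(u in `]0, s[) Y u) ->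
  forall s, 0 < s < m -> X s = Y s.
Proof.
move=> cX cY iX iY XY s /[dup] sm /andP[s0 ltsm].
have dX := is_derive_primitive cX iX sm; have dY := is_derive_primitive cY iY sm.
rewrite -(@derive_val _ _ _ _ _ _ _ dX) -(@derive_val _ _ _ _ _ _ _ dY).
apply: near_eq_derive => //; near=> u.
have um : 0 < u < m.
  by apply/andP; split; near: u; [exact: lt_nbhsr|exact: lt_nbhsl].
by rewrite !Rintegral_itv_cc_oo ?XY//; [exact: iY|exact: iX].
Unshelve. all: by end_near. Qed.

(** Inversion of the Abel operator. With H the integral of order 1 - c of X, one
has H = x0 + I^1 D. Applying I^c, the left-hand side becomes I^1 X, and the
right-hand side becomes I^1 of the announced expression, because I^c and I^1
commute and I^c 1 is the primitive of a multiple of s^(c-1). Both functions are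
continuous, hence equal. *)
Lemma rl_inversion m c (x0 : R) X D : 0 < c <= 1 ->
  (forall s, 0 < s < m -> {for s, continuous X}) -> locint m X ->
  (forall s, 0 < s < m -> is_derive s 1 (rl (1 - c) X) (D s)) ->
  (forall s, 0 < s < m -> {for s, continuous D}) -> locint m D ->
  rl (1 - c) X s @[s --> 0^'+] --> x0 ->
  forall s, 0 < s < m -> X s = x0 / Gamma c * s `^ (c - 1) + rl c D s.
Proof.
move=> /[dup] c01 /andP[c0 c1] cX iX dH cD iD H0.
have HE := integral_derivative_oo dH cD iD.1 H0.
have D1 : locint m (rl 1 D) by apply: rl_locint => //; rewrite ler01 lexx.
have cD1 : locint m (rl c D) by apply: rl_locint => //; rewrite ltW.
have pw : locint m (fun s => x0 / Gamma c * s `^ (c - 1)).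
  exact/locintZ/locint_powR.
apply: integral_inj_continuous => //.
- move=> s sm; apply: continuousD; last exact: (rl_continuous c01 iD).
  apply: (@continuousM _ _ (cst (x0 / Gamma c)) (fun s => s `^ (c - 1))).
    exact: cst_continuous.
  by apply: powR_continuous; case/andP: sm.
- exact: iX.1.
- exact: (locintD pw cD1).1.
move=> s /[dup] sm /andP[s0 ltsm].
have c1c : 0 <= 1 - c <= 1 by lra.
have E1 : rl c (rl (1 - c) X) s = \int[mu]_(u in `]0, s[) X u.
  by rewrite (rl_rl (ltW c0) c1c iX sm) addrC subrK rl1.
have E2 : rl c (rl (1 - c) X) s = rl c (fun u => cst x0 u + rl 1 D u) s.
  apply: eq_rl => // u /andP[u0 us]; rewrite rl1.
  by apply: HE; rewrite u0 (le_lt_trans us).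
have l01 : 0 <= (1 : R) <= 1 by rewrite ler01 lexx.
have c01' : 0 <= c <= 1 by rewrite ltW.
rewrite -E1 E2 (rlD (ltW c0) (locint_cst m x0) D1 sm).
rewrite (rl_rl (ltW c0) l01 iD sm) addrC [c + 1]addrC -(rl_rl ler01 c01' iD sm) rl1.
rewrite RintegralD//; last 2 first.
- exact: pw.1.
- exact: cD1.1.
rewrite addrC; congr (_ + _).
have k2 := Rintegral_kernel_right c0 s0.
rewrite RintegralZl//; last exact: (locint_powR m c0).1.
rewrite (_ : \int[mu]_(_ in _) _ = s `^ c / c); last first.
  by rewrite -[s in RHS]subr0 -k2; apply: eq_Rintegral => u _; rewrite subr0.
rewrite rl_gt0// /abel RintegralZl//; last exact: integrable_kernel_left.
rewrite Rintegral_kernel_left// subr0.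
by rewrite mulrCA mulrA.
Qed.
End RiemannLiouville.

(** * Continuation of a Volterra solution *)

Section Picard.
Context {R : realType}.
Implicit Types (y z : R -> R) (I : set R) (C : R).

Lemma le_geometric_half_le0 (x C : R) : (forall n, x <= C * 2^-1 ^+ n) -> x <= 0.
Proof.
move=> xC.
have h : geometric C 2^-1 n @[n --> \oo] --> (0 : R).
  by apply: cvg_geometric; rewrite gtr0_norm ?invr_gt0// invf_lt1// ltr1n.
rewrite -(cvg_lim (@Rhausdorff R) h); apply: limr_ge; first exact: (cvgP _ h).
exact: nearW.
Qed.

(** Picard iteration for a contraction of ratio 1/2 in the uniform distance on I,
inside a class of functions closed under such limits. The limit is obtained
pointwise: the iterates shifted down by their error bound increase, and stay
below the iterates shifted up by it. *)
Lemma picard_fixpoint I (P : (R -> R) -> R -> R) (good : (R -> R) -> Prop) y0 C :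
  good y0 -> (forall y, good y -> good (P y)) ->
  (forall y z K, good y -> good z -> (forall t, I t -> `|y t - z t| <= K) ->
     forall t, I t -> `|P y t - P z t| <= K / 2) ->
  (forall t, I t -> `|P y0 t - y0 t| <= C) ->
  (forall (u : nat -> R -> R) K y, (forall n, good (u n)) ->
     (forall n t, I t -> `|u n t - y t| <= K * 2^-1 ^+ n) -> good y) ->
  exists2 y, good y & forall t, I t -> y t = P y t.
Proof.
move=> g0 gP cP C0 gl.
pose u n := iter n P y0.
have gu n : good (u n) by elim: n => //= n; exact: gP.
have du n t : I t -> `|u n.+1 t - u n t| <= C * 2^-1 ^+ n.
  elim: n t => [|n IH] t It; first by rewrite expr0 mulr1; exact: C0.
  by rewrite exprSr mulrA; apply: (cP (u n.+1) (u n)).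
(* a n and b n enclose the limit because the remaining steps sum to at most
   2 * C * 2^-1 ^+ n. *)
pose a n t := u n t - 2 * C * 2^-1 ^+ n.
pose b n t := u n t + 2 * C * 2^-1 ^+ n.
have aS n t : I t -> a n t <= a n.+1 t.
  move=> It; have := du n t It; rewrite ler_norml /a exprSr; move: (2^-1 ^+ n) => q; lra.
have bS n t : I t -> b n.+1 t <= b n t.
  move=> It; have := du n t It; rewrite ler_norml /b exprSr; move: (2^-1 ^+ n) => q; lra.
have aD n k t : I t -> a n t <= a (n + k)%N t.
  by move=> It; elim: k => [|k IH]; rewrite ?addn0// addnS (le_trans IH)// aS.
have bD n k t : I t -> b (n + k)%N t <= b n t.
  by move=> It; elim: k => [|k IH]; rewrite ?addn0// addnS (le_trans _ IH)// bS.
have C_ge0 t : I t -> 0 <= C by move=> It; rewrite (le_trans _ (C0 t It)).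
have ab n k t : I t -> a n t <= b k t.
  move=> It; rewrite (le_trans (aD n k t It))// (le_trans _ (bD k n t It))//.
  rewrite addnC /a /b lerD2l.
  have := C_ge0 t It; have : 0 <= 2^-1 ^+ (k + n) :> R by rewrite exprn_ge0.
  by move=> h1 h2; rewrite (@le_trans _ _ 0)// ?oppr_le0 !mulr_ge0.
pose y t := sup (range (fun n => a n t)).
have yu n t : I t -> `|u n t - y t| <= 2 * C * 2^-1 ^+ n.
  move=> It.
  have ay : a n t <= y t.
    apply: ub_le_sup; last by exists n.
    by exists (b 0%N t) => _ [k _ <-]; exact: ab.
  have yb : y t <= b n t.
    apply: ge_sup; first by exists (a 0%N t); exists 0%N.
    by move=> _ [k _ <-]; exact: ab.
  move: ay yb; rewrite ler_norml /a /b; move: (2 * C * _) => q; lra.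
have gy : good y by apply: (gl u (2 * C)).
exists y => // t It; apply/eqP; rewrite -subr_eq0 -normr_le0; apply/eqP.
apply/eqP; apply: (@le_geometric_half_le0 _ (2 * C)) => n.
have h1 := yu n.+1 t It.
have h2 := cP (u n) y _ (gu n) gy (yu n) t It.
rewrite (_ : y t - P y t = - (u n.+1 t - y t) + (P (u n) t - P y t)); last first.
  by rewrite /u/=; ring.
rewrite (le_trans (ler_normD _ _))// normrN (le_trans (lerD h1 h2))//.
rewrite exprSr; move: (2^-1 ^+ n) => q; lra.
Qed.
End Picard.

Section Continuation.
Context {R : realType}.
Notation mu := (@lebesgue_measure R).
Implicit Types (a b c d e m r s t u v M K : R) (f g h y z X Y F : R -> R).

Lemma eq_locint m f g : (forall u, 0 < u < m -> f u = g u) ->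
  locint m f -> locint m g.
Proof.
move=> fg [fi fb]; split=> [s /[dup] sm /andP[s0 ltsm]|e s e0 sm].
  apply: (eq_integrable _ _ _ _ (fi s sm)) => // u; rewrite inE/= in_itv/= => /andP[u0 us].
  by rewrite fg// u0 (lt_trans us).
have [M fM] := fb e s e0 sm; exists M => u /andP[eu us].
by rewrite -fg ?fM ?eu//; rewrite (lt_le_trans e0 eu) (le_lt_trans us).
Qed.

Lemma bounded_locint m f M : measurable_fun setT f ->
  (forall u, `|f u| <= M) -> locint m f.
Proof.
move=> mf fM; split=> [s sm|e s _ _]; last by exists M.
apply: (@le_Rintegrable _ _ _ (cst M)) => //.
  exact: measurable_funTS.
exact: (locint_cst m M).1.
Qed.

(** Boundedness up to r supplies the integrability at r that the class, which says
nothing at the right end, does not give. *)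
Lemma locint_glue r m f : 0 < r -> locint r f -> measurable_fun `]0, r[ f ->
  (forall e, 0 < e -> exists M, forall u, e <= u < r -> `|f u| <= M) ->
  locint m (f \_ `]0, r[).
Proof.
move=> r0 [fi _] mf fb; split=> [s sm|e s e0 _].
  have h0 : 0 < r / 2 by rewrite divr_gt0.
  have [M fM] := fb _ h0.
  have hr : 0 < r / 2 < r by lra.
  apply: (@le_Rintegrable _ _ _ (fun u => `|(f \_ `]0, r / 2[) u| + `|M|)) => //.
  - apply: measurable_funTS.
    by apply/(measurable_restrictT _ (measurable_itv _)).
  - move=> u _; rewrite !patchE; case: ifPn => [|_]; last by rewrite normr0 addr_ge0.
    rewrite inE/= in_itv/= => /andP[u0 ur]; case: ifPn => [_|/negP]; first by rewrite lerDl.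
    rewrite inE/= in_itv/= u0/= => /negP; rewrite -leNgt => ru.
    by rewrite normr0 add0r (le_trans (fM u _)) ?ler_norm// ru.
  - apply: Rintegrable_add => //; last exact: (locint_cst m `|M|).1.
    apply: integrable_norm; apply: (@integrableS _ _ _ _ setT) => //.
    by rewrite -restrict_EFin; apply/(integrable_mkcond _ _).1 => //; exact: fi.
have [M fM] := fb e e0; exists `|M| => u /andP[eu us]; rewrite patchE.
case: ifPn => [|_]; last by rewrite normr0.
by rewrite inE/= in_itv/= => /andP[_ ur]; rewrite (le_trans (fM u _)) ?ler_norm// eu.
Qed.

(** For F supported in [r, s[ the integral is of the order of (s - r)^a: this is
what makes the integral operator a contraction just after r. *)
Lemma rl_bound a r s M m F : 0 < a -> 0 < r <= s -> s < m -> locint m F -> 0 <= M ->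
  (forall u, 0 < u < r -> F u = 0) -> (forall u, r <= u < s -> `|F u| <= M) ->
  `|rl a F s| <= M * ((Gamma a)^-1 * ((s - r) `^ a / a)).
Proof.
move=> a0 /andP[r0 rs] sm Fm M0 Fr FM.
have s0 := lt_le_trans r0 rs; have sm' : 0 < s < m by rewrite s0.
have Fi := abel_integrable a0 Fm sm'.
rewrite rl_gt0// normrM gtr0_norm ?invr_gt0 ?Gamma_gt0// mulrCA ler_wpM2l//.
  by rewrite invr_ge0 ltW// Gamma_gt0.
move: rs; rewrite le_eqVlt => /predU1P[rs|rs].
  rewrite /abel (_ : \int[mu]_(_ in _) _ = \int[mu]_(_ in `]0, s[) 0); last first.
    by apply: eq_Rintegral => u; rewrite inE/= in_itv/= -rs => /Fr ->; rewrite mul0r.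
  by rewrite Rintegral_cst// mul0r normr0 mulr_ge0// divr_ge0 ?powR_ge0// ltW.
have i1 : mu.-integrable `]0, r[ (EFin \o (fun u => F u * (s - u) `^ (a - 1))).
  apply: integrableS Fi => // x /=; rewrite !in_itv/= => /andP[-> xr].
  exact: lt_trans xr rs.
have i2 : mu.-integrable `]r, s[ (EFin \o (fun u => F u * (s - u) `^ (a - 1))).
  apply: integrableS Fi => // x /=; rewrite !in_itv/= => /andP[rx ->].
  by rewrite (lt_trans r0 rx).
have E1 : \int[mu]_(u in `]0, r]) (F u * (s - u) `^ (a - 1)) = 0.
  rewrite -Rintegral_itv_bndo_bndc//.
  rewrite (_ : \int[mu]_(_ in _) _ = \int[mu]_(_ in `]0, r[) 0); last first.
    by apply: eq_Rintegral => u; rewrite inE/= in_itv/= => /Fr ->; rewrite mul0r.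
  by rewrite Rintegral_cst// mul0r.
have -> : abel a F s = \int[mu]_(u in `]r, s[) (F u * (s - u) `^ (a - 1)).
  have := Rintegral_itvB Fi (_ : (BRight 0 <= BRight r)%O) (_ : (BRight r <= BLeft s)%O).
  rewrite !bnd_simp => /(_ (ltW r0) rs) <-.
  by rewrite E1 subr0.
rewrite -(Rintegral_kernel_left a0 rs) -RintegralZl//; last exact: integrable_kernel_left.
rewrite (le_trans (le_normr_Rintegral _ _))//.
apply: le_Rintegral => //.
- exact: (integrable_norm i2).
- by apply: Rintegrable_scale => //; exact: integrable_kernel_left.
- move=> u; rewrite /= in_itv/= => /andP[ru us].
  rewrite normrM (ger0_norm (powR_ge0 _ _)) ler_wpM2r ?powR_ge0// FM//.
  by rewrite us ltW.
Qed.

Lemma continuous_itv_bounded c d f : (forall s, c <= s <= d -> {for s, continuous f}) ->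
  exists2 M, 0 <= M & forall s, c <= s <= d -> `|f s| <= M.
Proof.
move=> cf; have [cd|dc] := lerP c d; last first.
  by exists 0 => // s /andP[cs sd]; have := le_trans cs sd; rewrite leNgt dc.
have cn : {within `[c, d], continuous (fun x => `|f x|)}.
  apply: continuous_in_subspaceT => x; rewrite inE/= in_itv/= => xcd.
  apply: (@continuous_comp _ _ _ f); last exact: norm_continuous.
  exact: cf.
have [z _ zmax] := EVT_max cd cn.
by exists `|f z| => // s scd; apply: zmax; rewrite in_itv.
Qed.

Section Extension.
Variables (a A r : R) (Phi : R -> R -> R) (g X : R -> R).
Hypotheses (a01 : 0 < a <= 1) (A0 : 0 < A) (r0 : 0 < r).
Hypothesis Phi_lip : forall u v w, 0 < u -> `|Phi u v - Phi u w| <= A * `|v - w|.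
Hypothesis Phi_cont : forall y s, 0 < s -> {for s, continuous y} ->
  {for s, continuous (fun u => Phi u (y u))}.
Hypothesis g_cont : forall s, 0 < s -> {for s, continuous g}.
Hypothesis X_cont : forall s, 0 < s < r -> {for s, continuous X}.
Hypothesis X_int : locint r (fun u => Phi u (X u)).
Hypothesis X_bnd : exists2 e, 0 < e < r & exists M, forall u, e < u < r -> `|X u| <= M.
Hypothesis X_eq : forall s, 0 < s < r -> X s = g s + rl a (fun u => Phi u (X u)) s.

Let a0 : 0 < a. Proof. by case/andP: a01. Qed.

Let Phi_bnd M c d : 0 < c -> exists K, forall u v, c <= u <= d -> `|v| <= M ->
  `|Phi u v| <= K.
Proof.
move=> c0.
have [K K0 PK] : exists2 K, 0 <= K & forall s, c <= s <= d -> `|Phi s (cst 0 s)| <= K.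
  apply: continuous_itv_bounded => s /andP[cs _].
  by apply: Phi_cont; [exact: lt_le_trans cs|exact: cst_continuous].
exists (A * M + K) => u v /[dup] ucd /andP[cu ud] vM.
rewrite -[Phi u v](subrK (Phi u 0)) (le_trans (ler_normD _ _))// lerD ?PK//.
rewrite (le_trans (Phi_lip _ _ _))//; first exact: lt_le_trans cu.
by rewrite subr0 ler_wpM2l// ltW.
Qed.

Let F0 : R -> R := (fun u => Phi u (X u)) \_ `]0, r[.

Let mPX : measurable_fun `]0, r[ (fun u => Phi u (X u)).
Proof.
apply: itv_open_continuous_measurable => x /andP[x0 xr].
by apply: Phi_cont => //; apply: X_cont; rewrite x0.
Qed.

Let F0_int m : locint m F0.
Proof.
apply: locint_glue => // e e0.
have [e1 /andP[e10 e1r] [M XM]] := X_bnd.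
pose e2 := (e1 + r) / 2.
have e12 : e1 < e2 by rewrite /e2; lra.
have e2r : e2 < r by rewrite /e2; lra.
have [M1 XM1] := X_int.2 e e2 e0 e2r.
have [K PK] := @Phi_bnd M e2 r (lt_trans e10 e12).
exists (Num.max M1 K) => u /andP[eu ur]; rewrite le_max.
have [ue2|e2u] := lerP u e2; first by rewrite XM1// eu.
by rewrite PK ?orbT// ?(ltW e2u) ?(ltW ur)// XM// (lt_trans e12).
Qed.

Let G s := g s + rl a F0 s.

Let G_cont s : 0 < s -> {for s, continuous G}.
Proof.
move=> s0; apply: continuousD; first exact: g_cont.
apply: (rl_continuous a01 (F0_int (s + 1))).
by rewrite s0 ltrDl ltr01.
Qed.

Let G_eq s : 0 < s < r -> G s = X s.
Proof.
move=> /[dup] sr /andP[s0 ltsr]; rewrite X_eq// /G; congr (_ + _).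
apply: eq_rl => // u /andP[u0 us]; rewrite /F0 patchE mem_set//= in_itv/= u0.
exact: le_lt_trans us ltsr.
Qed.

(** A length d with A d^a / (a Gamma(a)) <= 1/2 makes the integral operator on
[r, r + d[ a contraction of ratio 1/2. *)
Let q := Gamma a * a / (2 * A).
Let d := Num.min 1 (q `^ a^-1).

Let Ga0 : 0 < Gamma a. Proof. exact: Gamma_gt0. Qed.

Let q0 : 0 < q. Proof. by rewrite !divr_gt0// ?mulr_gt0. Qed.

Let d0 : 0 < d. Proof. by rewrite lt_min ltr01 powR_gt0. Qed.

Let kernel_small s : r <= s -> s < r + d ->
  (Gamma a)^-1 * ((s - r) `^ a / a) <= (2 * A)^-1.
Proof.
move=> rs sd.
have : (s - r) `^ a <= q.
  rewrite -[leRHS](@powR_invK _ a) ?gt_eqF ?(ltW q0)//.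
  rewrite ge0_ler_powR ?nnegrE ?powR_ge0 ?(ltW a0) ?subr_ge0//.
  have : d <= q `^ a^-1 by rewrite ge_min lexx orbT.
  lra.
rewrite /q => sq.
rewrite (@le_trans _ _ ((Gamma a)^-1 * (Gamma a * a / (2 * A) / a)))//.
  by rewrite ler_wpM2l ?invr_ge0 ?(ltW Ga0)// ler_wpM2r ?invr_ge0 ?(ltW a0).
move: (Gamma a) Ga0 => c c0; rewrite le_eqVlt; apply/orP; left; apply/eqP.
by field; rewrite !gt_eqF.
Qed.

Let I : set R := `[r, r + d[%classic.
(** The right-hand side is only evaluated on I, so that P y depends on the values
of y on I alone. *)
Let cut y : R -> R := (fun u => Phi u (y u)) \_ I.
Let P y s := G s + rl a (cut y) s.
Let good y := measurable_fun I (fun u => Phi u (y u)) /\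
  exists M, forall u, I u -> `|y u| <= M.

Let I_gt0 u : I u -> 0 < u.
Proof. by rewrite /I/= in_itv/= => /andP[ru _]; exact: lt_le_trans ru. Qed.

Let cut_bnd y : good y -> exists2 K, 0 <= K & forall u, `|cut y u| <= K.
Proof.
move=> [_ [M yM]]; have [K PK] := @Phi_bnd M r (r + d) r0.
exists `|K| => // u; rewrite /cut patchE; case: ifPn => [|_]; last by rewrite normr0.
rewrite inE => Iu; rewrite (le_trans (PK _ _ _ (yM u Iu))) ?ler_norm//.
by move: Iu; rewrite /I/= in_itv/= => /andP[-> /ltW].
Qed.

Let cut_int y m : good y -> locint m (cut y).
Proof.
move=> gy; have [K _ yK] := cut_bnd gy.
apply: bounded_locint yK.
by apply/(measurable_restrictT _ (measurable_itv _)); case: gy.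
Qed.

Let cut0 y u : 0 < u < r -> cut y u = 0.
Proof.
move=> /andP[_ ur]; rewrite /cut patchE memNset//= /I/= in_itv/=.
by apply/negP; rewrite negb_and -ltNge ur.
Qed.

Let P_cont y s : good y -> 0 < s -> {for s, continuous (P y)}.
Proof.
move=> gy s0; apply: continuousD; first exact: G_cont.
apply: (rl_continuous a01 (cut_int (s + 1) gy)).
by rewrite s0 ltrDl ltr01.
Qed.

Let good_continuous y : (forall s, 0 < s -> {for s, continuous y}) -> good y.
Proof.
move=> cy; split.
  apply: (@measurable_funS _ _ _ _ `]0, r + d[%classic) => //.
    by move=> u /[dup] /I_gt0; rewrite /I/= !in_itv/= => -> /andP[].
  apply: itv_open_continuous_measurable => x /andP[x0 _].
  by apply: Phi_cont => //; exact: cy.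
have [M M0 yM] : exists2 M, 0 <= M & forall s, r <= s <= r + d -> `|y s| <= M.
  by apply: continuous_itv_bounded => s /andP[rs _]; apply: cy; exact: lt_le_trans rs.
by exists M => u; rewrite /I/= in_itv/= => /andP[ru /ltW ud]; rewrite yM// ru.
Qed.

Let P_contraction y z K : good y -> good z ->
  (forall t, I t -> `|y t - z t| <= K) -> forall t, I t -> `|P y t - P z t| <= K / 2.
Proof.
move=> gy gz yz t It.
have t0 := I_gt0 It.
have K0 : 0 <= K by rewrite (le_trans _ (yz t It)).
have tm : 0 < t < t + 1 by rewrite t0 ltrDl ltr01.
have cz : locint (t + 1) (fun u => -1 * cut z u) by exact/locintZ/cut_int.
have cy : locint (t + 1) (cut y) by exact: cut_int.
have -> : P y t - P z t = rl a (fun u => cut y u + -1 * cut z u) t.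
  rewrite (rlD (ltW a0) cy cz tm) (rlZ _ (ltW a0) (cut_int (t + 1) gz) tm) /P.
  by ring.
have [rt td] : r <= t /\ t < r + d by move: It; rewrite /I/= in_itv/= => /andP[].
rewrite (le_trans (@rl_bound a r t (A * K) (t + 1) _ _ _ _ _ _ _ _))//.
- by rewrite r0 rt.
- by rewrite ltrDl ltr01.
- exact: locintD.
- by rewrite mulr_ge0// ltW.
- by move=> u ur; rewrite !cut0// mulr0 addr0.
- move=> u /andP[ru ut].
  have Iu : I u by rewrite /I/= in_itv/= ru (lt_trans ut).
  rewrite /cut !patchE !mem_set// mulN1r (le_trans (Phi_lip _ _ _))//; first exact: I_gt0.
  by rewrite ler_wpM2l ?(ltW A0)// yz.
- have /(ler_wpM2l (mulr_ge0 (ltW A0) K0)) := kernel_small rt td.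
  move=> /le_trans; apply; rewrite le_eqVlt; apply/orP; left; apply/eqP.
  by field; rewrite gt_eqF.
Qed.

(** A Volterra solution X on ]0, r[ that is bounded near r extends beyond r. The
right-hand side along X, cut off at r, is a fixed source; what remains is an
equation on [r, r + d[ for the values after r, whose integral operator contracts
for small d by the Lipschitz condition. The glued function is continuous across
r because Abel integrals of locally bounded functions are. *)
Lemma volterra_extension : exists2 r', r < r' & exists Y,
  [/\ forall u, 0 < u < r -> Y u = X u,
      forall s, 0 < s < r' -> {for s, continuous Y},
      locint r' (fun u => Phi u (Y u)) &
      forall s, 0 < s < r' -> Y s = g s + rl a (fun u => Phi u (Y u)) s].
Proof.
have gG : good G by apply: good_continuous => s; exact: G_cont.
have [C C0 GC] : exists2 C, 0 <= C & forall s, r <= s <= r + d -> `|P G s - G s| <= C.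
  apply: continuous_itv_bounded => s /andP[rs _].
  have s0 := lt_le_trans r0 rs.
  by apply: continuousB; [exact: P_cont|exact: G_cont].
have [||||y gy yP] := @picard_fixpoint R I P good G C gG.
- by move=> y gy; apply: good_continuous => s s0; exact: P_cont.
- exact: P_contraction.
- by move=> t; rewrite /I/= in_itv/= => /andP[rt /ltW td]; rewrite GC// rt.
- move=> u K y gu uy; split.
    apply: (@measurable_fun_cvg _ _ _ _ (fun n t => Phi t (u n t))).
      by move=> n; case: (gu n).
    move=> t It; apply/cvgrPdist_le => e e0.
    have h : geometric (A * K) 2^-1 n @[n --> \oo] --> (0 : R).
      by apply: cvg_geometric; rewrite gtr0_norm ?invr_gt0// invf_lt1// ltr1n.
    have {}h := cvgr_le _ h _ e0; near=> n.
    rewrite (le_trans (Phi_lip _ _ _)) ?(I_gt0 It)//.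
    rewrite (@le_trans _ _ (A * (K * 2^-1 ^+ n)))//.
      by rewrite ler_wpM2l ?(ltW A0)// distrC uy.
    rewrite mulrA; near: n; exact: h.
  have [_ [M uM]] := gu 0%N.
  exists (M + K) => t It; rewrite -[y t](subKr (u 0%N t)).
  rewrite (le_trans (ler_normB _ _))// lerD ?uM//.
  by have := uy 0%N t It; rewrite expr0 mulr1.
exists (r + d); first by rewrite ltrDl.
exists (P y).
have PX s : 0 < s < r -> P y s = X s.
  move=> /[dup] sr /andP[s0 ltsr]; rewrite /P G_eq// (_ : rl a _ s = 0) ?addr0//.
  have cs : locint r (cst (0 : R)) := locint_cst r 0.
  rewrite (@eq_rl _ a _ (fun u => 0 * cst 0 u))//.
    by rewrite (rlZ 0 (ltW a0) cs sr) mul0r.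
  move=> u /andP[u0 us]; rewrite mul0r cut0// u0; exact: le_lt_trans us ltsr.
have PE u : 0 < u < r + d -> F0 u + cut y u = Phi u (P y u).
  move=> /andP[u0 ud]; have [ur|ru] := ltrP u r.
    rewrite cut0 ?u0// addr0 PX ?u0// /F0 patchE mem_set//= in_itv/= u0.
    exact: ur.
  have Iu : I u by rewrite /I/= in_itv/= ru.
  rewrite /F0 patchE memNset/=; last by rewrite in_itv/= u0/= ltNge ru.
  by rewrite add0r /cut patchE mem_set// yP.
split => //.
- by move=> s /andP[s0 _]; exact: P_cont.
- apply: eq_locint PE _; apply: locintD; first exact: F0_int.
  exact: cut_int.
- move=> s /[dup] sd /andP[s0 ltsd].
  have -> : P y s = g s + (rl a F0 s + rl a (cut y) s) by exact/esym/addrA.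
  rewrite -(rlD (ltW a0) (F0_int _) (cut_int _ gy) sd).
  apply/eqP; rewrite (inj_eq (addrI _)); apply/eqP; apply: eq_rl => // u /andP[u0 us]; apply: PE; rewrite u0.
  exact: le_lt_trans us ltsd.
Unshelve. all: by end_near. Qed.
End Extension.
End Continuation.

(** * From Katugampola to Riemann-Liouville integrals *)

Section ChangeOfVariable.
Context {R : realType}.
Notation mu := (@lebesgue_measure R).
Implicit Types (a b c m s t u v : R) (f x : R -> R).
Variable rho : R.
Hypothesis rho0 : 0 < rho.

(** The variable s = t^rho / rho, in which t^(1-rho) d/dt is d/ds and the
Katugampola integrals are the Riemann-Liouville ones. *)
Definition kat_var t : R := t `^ rho / rho.
Definition kat_inv s : R := (rho * s) `^ rho^-1.

Let rhoN0 : rho != 0. Proof. by rewrite gt_eqF. Qed.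

Lemma kat_var_gt0 t : 0 < t -> 0 < kat_var t.
Proof. by move=> t0; rewrite divr_gt0// powR_gt0. Qed.

Lemma kat_inv_gt0 s : 0 < s -> 0 < kat_inv s.
Proof. by move=> s0; rewrite powR_gt0// mulr_gt0. Qed.

Lemma kat_varK t : 0 < t -> kat_inv (kat_var t) = t.
Proof.
move=> t0; rewrite /kat_inv /kat_var mulrCA mulfV// mulr1.
by rewrite -powRrM mulfV// powRr1// ltW.
Qed.

Lemma kat_invK s : 0 < s -> kat_var (kat_inv s) = s.
Proof.
move=> s0; rewrite /kat_inv /kat_var powR_invK// ?mulr_ge0 ?(ltW s0) ?(ltW rho0)//.
by rewrite mulrC mulrA mulVf// mul1r.
Qed.

Lemma kat_var_lt t u : 0 < t -> t < u -> kat_var t < kat_var u.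
Proof.
move=> t0 tu; rewrite /kat_var ltr_pM2r ?invr_gt0//.
by rewrite gt0_ltr_powR ?nnegrE// ltW// (lt_trans t0).
Qed.

Lemma kat_inv_lt s u : 0 < s -> s < u -> kat_inv s < kat_inv u.
Proof.
move=> s0 su; have u0 := lt_trans s0 su.
by rewrite /kat_inv gt0_ltr_powR ?invr_gt0// ?nnegrE ?ltr_pM2l// mulr_ge0 ?(ltW rho0)// ltW.
Qed.

Lemma kat_var_continuous t : 0 < t -> {for t, continuous kat_var}.
Proof.
move=> t0; apply: (@continuousM _ _ (fun t => t `^ rho) (cst rho^-1)).
  exact: powR_continuous.
exact: cst_continuous.
Qed.

Lemma is_derive_kat_inv s : 0 < s -> is_derive s 1 kat_inv (kat_inv s `^ (1 - rho)).
Proof.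
move=> s0; have rs0 : 0 < rho * s by rewrite mulr_gt0.
have d1 : is_derive s 1 (fun s => rho * s) rho.
  by apply: is_derive_eq; rewrite /GRing.scale/= mulr1.
have := @is_derive1_comp R (@powR R ^~ rho^-1) (fun s => rho * s) s _ _
  (is_derive1_powR rho^-1 rs0) d1.
rewrite (_ : rho^-1 * (rho * s) `^ (rho^-1 - 1) * rho = kat_inv s `^ (1 - rho))//.
rewrite mulrAC mulVf// mul1r /kat_inv -powRrM; congr (_ `^ _).
by rewrite mulrBr mulr1 mulVf.
Qed.

Lemma kat_inv_continuous s : 0 < s -> {for s, continuous kat_inv}.
Proof.
move=> s0; apply: differentiable_continuous; apply/derivable1_diffP.
by have [] := is_derive_kat_inv s0.
Qed.

Lemma is_derive_kat_var t : 0 < t -> is_derive t 1 kat_var (t `^ (rho - 1)).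
Proof.
move=> t0; have d1 := is_derive1_powR rho t0.
rewrite (_ : kat_var = rho^-1 \*: (@powR R ^~ rho)); last first.
  by apply/funext => z; rewrite /kat_var /GRing.scale/= mulrC.
by apply: is_derive_eq; rewrite /GRing.scale/= mulrA mulVf// mul1r.
Qed.

Lemma kat_subst t (G : R -> R) : 0 < t ->
  (forall u, 0 < u < kat_var t -> {for u, continuous G}) ->
  (mu.-integrable `]0, kat_var t[ (fun u => (G u)%:E) <->
   mu.-integrable `]0, t[ (fun v => (G (kat_var v) * v `^ (rho - 1))%:E)) /\
  (\int[mu]_(u in `]0%R, kat_var t[) (G u)%:E =
   \int[mu]_(v in `]0%R, t[) (G (kat_var v) * v `^ (rho - 1))%:E)%E.
Proof.
move=> t0 cG; apply: (@subst_increasing_oo R 0 t 0 (kat_var t) kat_var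
   (fun v => v `^ (rho - 1)) G); [by []|..|exact: cG].
- by move=> v /andP[v0 _]; exact: is_derive_kat_var.
- by move=> v /andP[v0 _]; exact: powR_continuous.
- by move=> v /andP[v0 _]; exact: powR_gt0.
- by move=> v /andP[v0 vt]; rewrite kat_var_gt0//= kat_var_lt.
- move=> u /andP[u0 ut]; exists (kat_inv u); last exact: kat_invK.
  by rewrite kat_inv_gt0//= -[ltRHS](kat_varK t0) kat_inv_lt.
Qed.

(** The substitution produces the Katugampola integrand up to the constant that
normalises the Katugampola integral. *)
Lemma kat_integrandE sigma f t v : 0 < v < t ->
  f (kat_inv (kat_var v)) * (kat_var t - kat_var v) `^ (sigma - 1) * v `^ (rho - 1) =
  rho `^ (1 - sigma) * kat_integrand rho sigma f t v.
Proof.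
move=> /andP[v0 vt]; rewrite kat_varK// /kat_integrand /kat_var -mulrBl.
rewrite powRM ?invr_ge0 ?(ltW rho0)//; last first.
  rewrite subr_ge0 ge0_ler_powR ?(ltW rho0) ?nnegrE ?(ltW v0) ?(ltW vt)//.
  exact/ltW/(lt_trans v0).
rewrite -[in RHS]powRN opprB -(powR_inv1 (ltW rho0)) -powRrM mulN1r opprB.
by ring.
Qed.

Lemma kat_abel sigma f t : 0 < t ->
  (forall u, 0 < u < t -> {for u, continuous f}) ->
  (mu.-integrable `]0, kat_var t[
     (EFin \o (fun u => f (kat_inv u) * (kat_var t - u) `^ (sigma - 1))) <->
   mu.-integrable `]0, t[ (EFin \o kat_integrand rho sigma f t)) /\
  (mu.-integrable `]0, t[ (EFin \o kat_integrand rho sigma f t) ->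
   abel sigma (f \o kat_inv) (kat_var t) =
   rho `^ (1 - sigma) * \int[mu]_(v in `]0, t[) kat_integrand rho sigma f t v).
Proof.
move=> t0 cf; have [|I E] := @kat_subst t
    (fun u => f (kat_inv u) * (kat_var t - u) `^ (sigma - 1)) t0.
  move=> u /andP[u0 ut]; apply: continuousM; last exact: powR_subl_continuous.
  apply: (@continuous_comp _ _ _ kat_inv f); first exact: kat_inv_continuous.
  by apply: cf; rewrite kat_inv_gt0//= -[ltRHS](kat_varK t0) kat_inv_lt.
have r0 : 0 < rho `^ (1 - sigma) by exact: powR_gt0.
have Eq (v : R) : `]0, t[%classic v ->
  f (kat_inv (kat_var v)) * (kat_var t - kat_var v) `^ (sigma - 1) * v `^ (rho - 1) =
  rho `^ (1 - sigma) * kat_integrand rho sigma f t v.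
  by rewrite /= in_itv/= => vt; rewrite kat_integrandE.
split.
  apply: (iff_trans I); split=> H.
    have H1 := eq_Rintegrable (measurable_itv _) Eq H.
    have := Rintegrable_scale (rho `^ (1 - sigma))^-1 (measurable_itv _) H1.
    apply: (eq_Rintegrable (measurable_itv _)) => v _.
    by apply: mulKf; rewrite gt_eqF.
  have H1 := Rintegrable_scale (rho `^ (1 - sigma)) (measurable_itv _) H.
  by apply: (eq_Rintegrable (measurable_itv _) _ H1) => v vt; rewrite -Eq.
move=> ki; rewrite [RHS](_ : _ = \int[mu]_(v in `]0, t[)
  (rho `^ (1 - sigma) * kat_integrand rho sigma f t v)); last by rewrite RintegralZl.
rewrite /abel /Rintegral E; congr fine.
by apply: eq_integral => v; rewrite inE => vt; rewrite Eq.
Qed.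

Lemma kat_rl m sigma f t : 0 <= sigma -> 0 < t -> kat_var t < m ->
  (forall u, 0 < u < t -> {for u, continuous f}) ->
  locint m (f \o kat_inv) ->
  kat_integral rho sigma f t = rl sigma (f \o kat_inv) (kat_var t).
Proof.
rewrite le_eqVlt => /predU1P[<-|s0] t0 tm cf fm.
  by rewrite rl0 /kat_integral eqxx/= kat_varK.
have [I E] := @kat_abel sigma f t t0 cf.
have sm : 0 < kat_var t < m by rewrite kat_var_gt0.
rewrite rl_gt0// E; last by apply/I; exact: (abel_integrable s0 fm sm).
rewrite /kat_integral (gt_eqF s0) [RHS]mulrA.
by apply: (congr1 (fun z => z * _)); exact: mulrC.
Qed.
End ChangeOfVariable.

(** * Solutions of the initial value problem as Abel solutions *)

Section OneSided.
Context {R : realType}.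

Lemma near_at_right0 (P : set R) : (\forall t \near 0^'+, P t) ->
  exists2 d : R, 0 < d & forall t, 0 < t < d -> P t.
Proof.
move=> /nbhs_ballP[d /= d0 dP]; exists d => // t /andP[t0 td]; apply: dP => //=.
by rewrite /ball/= sub0r normrN gtr0_norm.
Qed.

Lemma near_right0I (P : set R) (d : R) : 0 < d -> (forall t, 0 < t < d -> P t) ->
  \forall t \near 0^'+, P t.
Proof.
move=> d0 dP; near=> t; apply: dP; apply/andP; split; near: t.
  exact: nbhs_right_gt.
exact: nbhs_right_lt.
Unshelve. all: by end_near. Qed.

Lemma cvg_at_right0_eq (f g : R -> R) (d l : R) : 0 < d ->
  (forall t, 0 < t < d -> f t = g t) ->
  f t @[t --> 0^'+] --> l -> g t @[t --> 0^'+] --> l.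
Proof.
move=> d0 fg; apply: cvg_trans; apply: near_eq_cvg.
exact: (near_right0I d0).
Qed.

Lemma cvg_at_right0_kat_inv (rho : R) (f : R -> R) (l : R) : 0 < rho ->
  f t @[t --> 0^'+] --> l -> f (kat_inv rho s) @[s --> 0^'+] --> l.
Proof.
move=> rho0 /cvgrPdist_lt fl; apply/cvgrPdist_lt => e /fl /near_at_right0[d d0 dP].
apply: (near_right0I (kat_var_gt0 rho0 d0)) => s /andP[s0 sd].
by apply: dP; rewrite kat_inv_gt0//= -[ltRHS](kat_varK rho0 d0) kat_inv_lt.
Qed.
End OneSided.

Section AbelSolutions.
Context {R : realType}.
Notation mu := (@lebesgue_measure R).
Variables (alpha beta rho x0 : R) (phi : R -> R -> R).
Hypotheses (alpha_itv : 0 < alpha < 1) (beta_itv : 0 <= beta <= 1) (rho0 : 0 < rho).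
Hypothesis phi_cont : {within [set p : R * R | 0 < p.1], continuous (fun p => phi p.1 p.2)}.

Let gam := hk_gamma alpha beta.
Let p := kat_var rho.
Let q := kat_inv rho.

Let gam01 : 0 < gam <= 1.
Proof.
case/andP: alpha_itv => a0 a1; case/andP: beta_itv => b0 b1.
have h1 : 0 <= beta * (1 - alpha) by rewrite mulr_ge0// subr_ge0 ltW.
have h2 : 0 <= (1 - beta) * (1 - alpha) by rewrite mulr_ge0// subr_ge0// ltW.
by rewrite /gam /hk_gamma; apply/andP; split; lra.
Qed.

Let gam0 : 0 < gam. Proof. by case/andP: gam01. Qed.
Let alpha0 : 0 < alpha. Proof. by case/andP: alpha_itv. Qed.

Lemma continuous_phi_comp (k1 k2 : R -> R) (s : R) : 0 < k1 s ->
  {for s, continuous k1} -> {for s, continuous k2} ->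
  {for s, continuous (fun u => phi (k1 u) (k2 u))}.
Proof.
move=> k0 c1 c2.
have oD : open [set z : R * R | 0 < z.1].
  rewrite (_ : [set z : R * R | 0 < z.1] = fst @^-1` `]0, +oo[%classic).
    by apply: open_comp; [move=> z _; exact: cvg_fst|exact: interval_open].
  by apply/seteqP; split => z /=; rewrite in_itv/= andbT.
have cF := phi_cont; rewrite continuous_open_subspace// in cF.
have cFs : {for (k1 s, k2 s), continuous (fun z : R * R => phi z.1 z.2)}.
  by apply: cF; rewrite inE.
apply: (@continuous_comp _ _ _ (fun u => (k1 u, k2 u)) (fun z : R * R => phi z.1 z.2)) => //.
exact: (cvg_pair c1 c2).
Qed.

(** The integral equation of the initial value problem in the variable s. *)
Definition abel_solution (m : R) (X : R -> R) : Prop :=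
  [/\ forall s, 0 < s < m -> {for s, continuous X},
      locint m (fun u => phi (q u) (X u)) &
      forall s, 0 < s < m -> X s = x0 / Gamma gam * s `^ (gam - 1) +
        rl alpha (fun u => phi (q u) (X u)) s].

Lemma locint_sup (m : R) (f : R -> R) :
  (forall m', 0 < m' < m -> locint m' f) -> locint m f.
Proof.
move=> H; split => [s sm|e s e0 sm].
  have := (H ((s + m) / 2)); case/andP: sm => s0 sm.
  by case=> [|+ _]; [lra|apply; lra].
have [es|se] := lerP e s; last first.
  by exists 0 => u /andP[eu us]; have := le_trans eu us; rewrite leNgt se.
have := (H ((s + m) / 2)); case=> [|_]; first by lra.
by apply; lra.
Qed.

Lemma weightedE (x : R -> R) (t : R) : 0 < t ->
  weighted rho gam x t = p t `^ (1 - gam) * x t.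
Proof. by []. Qed.

(** A function of the weighted space is the product of a bounded continuous function
and s^(gamma-1), whose exponent exceeds -1. *)
Lemma Cw_regular (b : R) (x : R -> R) : 0 < b -> in_Cw rho gam b x ->
  (forall t, 0 < t < b -> {for t, continuous x}) /\ locint (p b) (x \o q).
Proof.
move=> b0 [z cz zx].
have xE t : 0 < t <= b -> x t = z t * p t `^ (gam - 1).
  move=> tb; rewrite zx// weightedE; last by case/andP: tb.
  have pt0 : 0 < p t by apply: kat_var_gt0 => //; case/andP: tb.
  rewrite mulrAC -powRD ?(gt_eqF pt0) ?implybT//.
  by rewrite (_ : 1 - gam + (gam - 1) = 0) ?powRr0 ?mul1r//; ring.
have cx t : 0 < t < b -> {for t, continuous x}.
  move=> /andP[t0 tb].
  have ct : {for t, continuous z}.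
    have [cz' _ _] := (continuous_within_itvP z b0).1 cz.
    by apply: cz'; rewrite in_itv/= t0.
  apply: (@continuous_near_eq _ (fun t => z t * p t `^ (gam - 1))).
    near=> u; apply: xE; apply/andP; split; near: u; first exact: lt_nbhsr.
    by apply: lt_le_nbhsl.
  apply: continuousM => //.
  apply: (@continuous_comp _ _ _ p (fun s => s `^ (gam - 1))).
    exact: kat_var_continuous.
  exact/powR_continuous/kat_var_gt0.
split => //; apply: continuous_locint => s /andP[s0 sb].
  apply: (@continuous_comp _ _ _ q x); first exact: kat_inv_continuous.
  by apply: cx; rewrite kat_inv_gt0//= -[ltRHS](kat_varK rho0 b0) kat_inv_lt.
have [M zM] : exists M, forall t, 0 <= t <= b -> `|z t| <= M.
  have cn : {within `[0, b], continuous (fun x => `|z x|)}.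
    by move=> t; apply: (@continuous_comp _ _ _ (z : subspace `[0, b]%classic -> R)); 
      [exact: cz|exact: norm_continuous].
  have [c _ cmax] := EVT_max (ltW b0) cn.
  by exists `|z c| => t tb; apply: cmax; rewrite in_itv.
have sqb u : 0 < u < s -> 0 < q u <= b.
  move=> /andP[u0 us]; rewrite kat_inv_gt0//= -[leRHS](kat_varK rho0 b0) ltW//.
  by rewrite kat_inv_lt// (lt_trans us).
apply: (@le_Rintegrable _ _ _ (fun u => M * u `^ (gam - 1))) => //.
- apply: itv_open_continuous_measurable => u /andP[u0 us].
  apply: (@continuous_comp _ _ _ q x); first exact: kat_inv_continuous.
  apply: cx; rewrite kat_inv_gt0//= -[ltRHS](kat_varK rho0 b0) kat_inv_lt//.
  exact: lt_trans sb.
- move=> u; rewrite /= in_itv/= => us; have /andP[u0 _] := us.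
  rewrite xE ?sqb// /p /q kat_invK// normrM [`|u `^ _|]ger0_norm ?powR_ge0//.
  rewrite ler_wpM2r ?powR_ge0// zM//.
  by have /andP[/ltW -> ->] := sqb u us.
- apply: Rintegrable_scale => //.
  have /(locint_powR (s + 1)) [+ _] := gam0; apply.
  by rewrite s0 ltrDl ltr01.
Unshelve. all: by end_near. Qed.

(** Since alpha <= 1, the kernel (s - u)^(alpha-1) is at least s^(alpha-1): the
integrability contained in the Volterra equation at time s gives that of the
right-hand side itself. *)
Lemma volterra_abel (b : R) (x : R -> R) : 0 < b ->
  (forall t, 0 < t < b -> {for t, continuous x}) ->
  volterra_equation rho alpha beta x0 phi b%:E x ->
  abel_solution (p b) (x \o q).
Proof.
move=> b0 cx vx.
have qb s : 0 < s < p b -> 0 < q s < b.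
  move=> /andP[s0 sb]; rewrite kat_inv_gt0//= -[ltRHS](kat_varK rho0 b0).
  by rewrite kat_inv_lt.
have cX s : 0 < s < p b -> {for s, continuous (x \o q)}.
  move=> sb; apply: (@continuous_comp _ _ _ q x); last exact/cx/qb.
  by apply: kat_inv_continuous => //; case/andP: sb.
pose f t := phi t (x t).
have cf t : 0 < t < b -> {for t, continuous f}.
  move=> tb; apply: (@continuous_phi_comp id x); last exact: cx.
    by case/andP: tb.
  exact: cvg_id.
have cF s : 0 < s < p b -> {for s, continuous (f \o q)}.
  move=> sb; apply: (@continuous_comp _ _ _ q f); last exact/cf/qb.
  by apply: kat_inv_continuous => //; case/andP: sb.
have kI t : 0 < t < b ->
    mu.-integrable `]0, t[ (EFin \o kat_integrand rho alpha f t).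
  by move=> /andP[t0 tb]; have [] := vx t t0; rewrite ?lte_fin.
have AI t : 0 < t < b ->
    mu.-integrable `]0, p t[ (EFin \o (fun u => (f \o q) u * (p t - u) `^ (alpha - 1))).
  move=> /[dup] tb /andP[t0 ltb].
  have cft u : 0 < u < t -> {for u, continuous f}.
    by move=> /andP[u0 ut]; apply: cf; rewrite u0 (lt_trans ut).
  have [I _] := kat_abel rho0 alpha t0 cft.
  by apply/I; exact: kI.
have fl : locint (p b) (f \o q).
  apply: continuous_locint => // s sb; have [s0 _] := andP sb.
  have := AI _ (qb s sb); rewrite /p /q kat_invK// => ai.
  apply: (@le_Rintegrable _ _ _ (fun u => s `^ (1 - alpha) *
     `|f (q u) * (s - u) `^ (alpha - 1)|)) => //.
  - apply: itv_open_continuous_measurable => u /andP[u0 us].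
    by apply: cF; rewrite u0 (lt_trans us)//; case/andP: sb.
  - move=> u; rewrite /= in_itv/= => /andP[u0 us].
    rewrite normrM [`|_ `^ _|]ger0_norm ?powR_ge0// mulrCA ler_peMr//.
    have su0 : 0 < s - u by rewrite subr_gt0.
    rewrite (@le_trans _ _ (s `^ (1 - alpha) * s `^ (alpha - 1)))//.
      rewrite -powRD ?(gt_eqF s0) ?implybT//.
      by rewrite (_ : 1 - alpha + (alpha - 1) = 0) ?powRr0//; ring.
    rewrite ler_wpM2l ?powR_ge0// le_powR_nonpos//.
      by case/andP: alpha_itv => _ /ltW; rewrite subr_le0.
    by rewrite gerBl ltW.
  - by apply: Rintegrable_scale => //; exact: integrable_norm ai.
split => // s sb.
have [s0 ltsb] := andP sb; have /andP[q0 qsb] := qb s sb.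
have qsb' : ((q s)%:E < b%:E)%E by rewrite lte_fin.
have [_ xE] := vx (q s) q0 qsb'.
have ps : p (q s) = s by rewrite /p /q kat_invK.
have {}xE : x (q s) = x0 / Gamma gam * p (q s) `^ (gam - 1) + kat_integral rho alpha f (q s).
  by rewrite [LHS]xE /kat_integral gt_eqF.
rewrite [LHS]xE (@kat_rl R rho rho0 (p b) alpha f) -/p ?ps ?(ltW alpha0)//.
by move=> u /andP[u0 uq]; apply: cf; rewrite u0 (lt_trans uq).
Qed.

Lemma abel_volterra (b : R) (x : R -> R) : 0 < b ->
  (forall t, 0 < t < b -> {for t, continuous x}) ->
  locint (p b) (fun u => phi (q u) (x (q u))) ->
  (forall s, 0 < s < p b -> x (q s) = x0 / Gamma gam * s `^ (gam - 1) +
        rl alpha (fun u => phi (q u) (x (q u))) s) ->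
  volterra_equation rho alpha beta x0 phi b%:E x.
Proof.
move=> b0 cx fl xE t t0; rewrite lte_fin => tb.
pose f t := phi t (x t).
have cf u : 0 < u < t -> {for u, continuous f}.
  move=> /andP[u0 ut]; apply: (@continuous_phi_comp id x) => //.
  by apply: cx; rewrite u0 (lt_trans ut).
have ptb : 0 < p t < p b by rewrite kat_var_gt0//= kat_var_lt.
have [I _] := kat_abel rho0 alpha t0 cf.
split.
  by apply/I; apply: (abel_integrable alpha0 fl ptb).
have tE : q (p t) = t by rewrite /p /q kat_varK.
have := xE (p t) ptb; rewrite tE => ->; congr (_ + _).
rewrite -[LHS](@kat_rl R rho rho0 (p b) alpha f) ?(ltW alpha0)//.
  by rewrite /kat_integral gt_eqF.
by case/andP: ptb.
Qed.

(** The classical equation implies the integral one. In the variable s, the function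
D = t^(1-rho) h' is the derivative of the integral H of order 1 - gamma of X, and
the equation says that I^(beta (1-alpha)) D is the right-hand side F. Hence
I^alpha F = I^gamma D by the semigroup law, and inverting H = I^(1-gamma) X
concludes. *)
Lemma hk_equation_abel (b : R) (x : R -> R) : 0 < b ->
  (forall t, 0 < t < b -> {for t, continuous x}) -> locint (p b) (x \o q) ->
  hk_equation rho alpha beta phi b%:E x ->
  kat_integral rho (1 - gam) x t @[t --> 0^'+] --> x0 ->
  abel_solution (p b) (x \o q).
Proof.
move=> b0 cx Xl [dx ex] xlim.
have /andP[_ gam1] := gam01.
have g1 : (1 - alpha) * (1 - beta) = 1 - gam by rewrite /gam /hk_gamma; ring.
have g2 : alpha + beta * (1 - alpha) = gam by [].
have be0 : 0 <= beta * (1 - alpha) <= 1.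
  case/andP: alpha_itv => a0 a1; case/andP: beta_itv => be0 be1.
  by rewrite mulr_ge0 ?mulr_ile1//; rewrite ?subr_ge0 ?gerBl ?(ltW a0) ?(ltW a1).
rewrite /hk_derivable g1 in dx.
pose h := kat_integral rho (1 - gam) x.
pose D := rho_derivative rho h.
have m0 : 0 < p b by exact: kat_var_gt0.
have qb s : 0 < s < p b -> 0 < q s < b.
  move=> /andP[s0 sb]; rewrite kat_inv_gt0//= -[ltRHS](kat_varK rho0 b0).
  by rewrite kat_inv_lt.
have dxb t : 0 < t < b -> [/\ derivable h t 1, {for t, continuous (derive1 h)} &
        mu.-integrable `]0, t[ (EFin \o derive1 h)].
  by move=> /andP[t0 tb]; apply: dx; rewrite ?lte_fin.
have cX s : 0 < s < p b -> {for s, continuous (x \o q)}.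
  move=> sb; apply: (@continuous_comp _ _ _ q x); last exact/cx/qb.
  by apply: kat_inv_continuous => //; case/andP: sb.
have cD t : 0 < t < b -> {for t, continuous D}.
  move=> tb; have [_ ch _] := dxb t tb; apply: continuousM => //.
  by apply: powR_continuous; case/andP: tb.
have cDq s : 0 < s < p b -> {for s, continuous (D \o q)}.
  move=> sb; apply: (@continuous_comp _ _ _ q D); last exact/cD/qb.
  by apply: kat_inv_continuous => //; case/andP: sb.
have iD : locint (p b) (D \o q).
  apply: continuous_locint => // s sb; have [s0 _] := andP sb.
  have /andP[q0 qsb] := qb s sb.
  have ps : p (q s) = s by rewrite /p /q kat_invK.
  have [||I _] := @kat_subst R rho rho0 (q s) (D \o q) => //.
    move=> u; rewrite -/p ps => /andP[u0 us]; apply: cDq.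
    by rewrite u0 (lt_trans us)//; case/andP: sb.
  move: I; rewrite -/p ps => I; apply/I.
  have [_ _ ih] := dxb _ (qb s sb).
  apply: eq_Rintegrable ih => // u; rewrite /= in_itv/= => /andP[u0 us].
  rewrite /D /rho_derivative /p /q/= kat_varK// mulrAC -powRD; last first.
    by rewrite (gt_eqF u0) implybT.
  by rewrite (_ : 1 - rho + (rho - 1) = 0) ?powRr0 ?mul1r//; ring.
have hE s : 0 < s < p b -> rl (1 - gam) (x \o q) s = h (q s).
  move=> sb; have [s0 ltsb] := andP sb; have /andP[q0 qsb] := qb s sb.
  have ps : p (q s) = s by rewrite /p /q kat_invK.
  rewrite /h (@kat_rl R rho rho0 (p b)) -/p ?ps ?subr_ge0//.
  by move=> u /andP[u0 uq]; apply: cx; rewrite u0 (lt_trans uq).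
have dH s : 0 < s < p b -> is_derive s 1 (rl (1 - gam) (x \o q)) ((D \o q) s).
  move=> sb; have [s0 ltsb] := andP sb.
  have [dh _ _] := dxb _ (qb s sb).
  apply: (@near_eq_is_derive _ _ _ (h \o q)).
    near=> u; apply/esym/hE; apply/andP; split; near: u.
      exact: lt_nbhsr.
    exact: lt_nbhsl.
  rewrite /= /D /rho_derivative mulrC.
  apply: is_derive1_comp; last exact: is_derive_kat_inv.
  by rewrite derive1E; exact: derivableP.
have Hlim : rl (1 - gam) (x \o q) s @[s --> 0^'+] --> x0.
  have := cvg_at_right0_kat_inv rho0 xlim; apply: (cvg_at_right0_eq m0).
  by move=> s sb; rewrite hE.
have XE := rl_inversion gam01 cX Xl dH cDq iD Hlim.
have FE s : 0 < s < p b -> rl (beta * (1 - alpha)) (D \o q) s = phi (q s) (x (q s)).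
  move=> sb; have [s0 ltsb] := andP sb; have /andP[q0 qsb] := qb s sb.
  have ps : p (q s) = s by rewrite /p /q kat_invK.
  rewrite -ex//.
  rewrite /hk_derivative g1 -/h -/D (@kat_rl R rho rho0 (p b)) -/p ?ps//.
    by case/andP: be0.
  by move=> u /andP[u0 uq]; apply: cD; rewrite u0 (lt_trans uq).
split; first exact: cX.
  by apply: eq_locint FE _; exact: rl_locint.
move=> s sb.
have E : rl gam (D \o q) s = rl alpha (fun u => phi (q u) ((x \o q) u)) s.
  rewrite -[in LHS]g2 -(rl_rl (ltW alpha0) be0 iD sb).
  have [s0 ltsb] := andP sb.
  by apply: eq_rl => // u /andP[u0 us]; apply: FE; rewrite u0 (le_lt_trans us).
by rewrite (XE s sb) E.
Unshelve. all: by end_near. Qed.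
End AbelSolutions.

(** * Continuation and the upper limit at the end point *)

Section LimSup.
Context {R : realType}.

Lemma limf_esup_le (f : R -> \bar R) (F : set_system R) (V : set R) (M : \bar R) :
  F V -> (forall t, V t -> (f t <= M)%E) -> (limf_esup f F <= M)%E.
Proof.
move=> FV fM; rewrite limf_esupE; apply: (@le_trans _ _ (ereal_sup (f @` V))).
  by apply: ereal_inf_lbound; exists V.
by apply: ge_ereal_sup => _ [t Vt <-]; exact: fM.
Qed.

Lemma limf_esup_fin_bound (f : R -> R) (F : set_system R) :
  limf_esup (fun t => (f t)%:E) F <> +oo%E ->
  exists2 V, F V & exists M, forall t, V t -> f t <= M.
Proof.
move=> /eqP; rewrite -ltey limf_esupE => /ereal_inf_lt[_ [V FV <-] supV].
exists V => //.
have fV t : V t -> ((f t)%:E <= ereal_sup [set (f t)%:E | t in V])%E.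
  by move=> Vt; apply: ereal_sup_ubound; exists t.
move: supV fV; case: (ereal_sup _) => [M| |] // _ fV.
  by exists M => t /fV; rewrite lee_fin.
by exists 0 => t /fV; rewrite leeNy_eq.
Qed.

Lemma near_at_left (r : R) (P : set R) : (\forall t \near r^'-, P t) ->
  exists2 d : R, 0 < d & forall t, r - d < t < r -> P t.
Proof.
move=> /nbhs_ballP[d /= d0 dP]; exists d => // t /andP[dt tr]; apply: dP => //=.
by rewrite /ball/= gtr0_norm ?subr_gt0// ltrBlDr addrC -ltrBlDr.
Qed.
End LimSup.

Section Solutions.
Context {R : realType}.
Variables (alpha beta rho x0 A : R) (phi : R -> R -> R).
Hypotheses (alpha_itv : 0 < alpha < 1) (beta_itv : 0 <= beta <= 1) (rho0 : 0 < rho).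
Hypothesis phi_cont : {within [set p : R * R | 0 < p.1], continuous (fun p => phi p.1 p.2)}.
Hypothesis A_gt0 : 0 < A.
Hypothesis phi_lip : forall t u v : R, 0 < t -> `|phi t u - phi t v| <= A * `|u - v|.

Let gam := hk_gamma alpha beta.
Let p := kat_var rho.
Let q := kat_inv rho.

Lemma abel_solution_sup (m : R) (X : R -> R) :
  (forall m', 0 < m' < m -> abel_solution alpha beta rho x0 phi m' X) ->
  abel_solution alpha beta rho x0 phi m X.
Proof.
move=> H; have mid s : 0 < s < m -> 0 < (s + m) / 2 < m /\ 0 < s < (s + m) / 2.
  by move=> /andP[s0 sm]; split; apply/andP; split; lra.
split.
- by move=> s /mid[/H[cX _ _]]; exact: cX.
- by apply: locint_sup => m' /H[].
- by move=> s /mid[/H[_ _ XE]]; exact: XE.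
Qed.

Lemma solution_abel (mu : \bar R) (x : R -> R) (b : R) :
  is_solution rho alpha beta x0 phi mu x -> 0 < b -> (b%:E < mu)%E ->
  abel_solution alpha beta rho x0 phi (p b) (x \o q) /\
  forall t, 0 < t < b -> {for t, continuous x}.
Proof.
move=> [xC xeq xlim] b0 bmu.
have [cx Xl] := Cw_regular alpha_itv beta_itv rho0 b0 (xC b b0 bmu).
split => //; case: xeq => [[dx ex]|vx].
  apply: (hk_equation_abel alpha_itv beta_itv rho0 b0 cx Xl _ xlim).
  by split=> [h t t0 tb|t t0 tb]; [apply: dx|apply: ex] => //; exact: lt_trans bmu.
apply: (volterra_abel alpha_itv rho0 phi_cont b0 cx) => t t0 tb.
by apply: vx => //; exact: lt_trans bmu.
Qed.

(** Membership in the weighted space is a condition at 0 and continuity elsewhere. *)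
Lemma in_Cw_glue (b b0 : R) (x y : R -> R) : 0 < b -> 0 < b0 ->
  in_Cw rho gam b0 x -> (forall t, 0 < t <= b0 -> y t = x t) ->
  (forall t, 0 < t <= b -> {for t, continuous y}) -> in_Cw rho gam b y.
Proof.
move=> b_gt0 b0_gt0 [z cz zx] yx cy.
(* the continuous extension of the weighted y, taken from that of x at 0 *)
pose w t := if t <= 0 then z 0 else weighted rho gam y t.
have wE t : 0 < t -> w t = weighted rho gam y t by move=> t0; rewrite /w leNgt t0.
have cw t : 0 < t <= b -> {for t, continuous w}.
  move=> /[dup] tb /andP[t0 _].
  apply: (@continuous_near_eq _ (weighted rho gam y)).
    near=> u; apply: wE; near: u; exact: lt_nbhsr.
  apply: continuousM; last exact: cy.
  apply: (@continuous_comp _ _ _ p (fun s => s `^ (1 - gam))).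
    exact: kat_var_continuous.
  exact/powR_continuous/kat_var_gt0.
exists w; last by move=> t /andP[t0 _]; exact: wE.
apply/(continuous_within_itvP _ b_gt0); split.
- by move=> t; rewrite in_itv/= => /andP[t0 tb]; apply: cw; rewrite t0 ltW.
- rewrite {2}/w lexx.
  have [_ z0 _] := (continuous_within_itvP z b0_gt0).1 cz.
  apply: (cvg_at_right0_eq b0_gt0) z0 => t /andP[t0 tb].
  have tb0 : 0 < t <= b0 by rewrite t0 ltW.
  by rewrite leNgt t0/= zx// /weighted yx.
- by apply/cvg_at_left_filter/cw; rewrite b_gt0 lexx.
Unshelve. all: by end_near. Qed.

(** The extension of the Abel solution, transported back to the variable t. The
continuation satisfies the Volterra form of the equation, and its initial value
is that of x because only values near 0 matter. *)
Lemma bounded_continuation (r : R) (x : R -> R) (d M : R) : 0 < r ->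
  is_solution rho alpha beta x0 phi r%:E x ->
  0 < d -> (forall t, r - d < t < r -> `|x t| <= M) ->
  exists muh xh, is_continuation rho alpha beta x0 phi r%:E x muh xh.
Proof.
move=> r0 xsol d0 xM.
have pr0 : 0 < p r by exact: kat_var_gt0.
have qpr s : 0 < s < p r -> 0 < q s < r.
  move=> /andP[s0 sr]; rewrite kat_inv_gt0//= -[ltRHS](kat_varK rho0 r0).
  by rewrite kat_inv_lt.
have [cX Xl XE] : abel_solution alpha beta rho x0 phi (p r) (x \o q).
  apply: abel_solution_sup => m' mr; have /andP[m0 ltmr] := mr.
  have /andP[q0 qr] := qpr m' mr.
  have qrE : ((q m')%:E < r%:E)%E by rewrite lte_fin.
  by have [+ _] := solution_abel xsol q0 qrE; rewrite /p /q kat_invK.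
(* the maximum keeps the lower end of the bounded stretch positive *)
pose e := Num.max (r - d) (r / 2).
have e0 : 0 < e by rewrite lt_max divr_gt0// orbT.
have er : e < r by rewrite gt_max; apply/andP; split; lra.
have Xb : exists2 e : R, 0 < e < p r & exists M : R, forall u, e < u < p r ->
    `|(x \o q) u| <= M.
  exists (p e); first by rewrite kat_var_gt0//= kat_var_lt.
  exists M => u /andP[eu ur].
  have u0 : 0 < u by rewrite (lt_trans _ eu)// kat_var_gt0.
  apply: xM; have ub : 0 < u < p r by rewrite u0.
  have /andP[_ ->] := qpr u ub; rewrite andbT; have : e < q u by rewrite -[ltLHS](kat_varK rho0 e0) kat_inv_lt ?kat_var_gt0.
  by rewrite gt_max => /andP[].
have g_cont s : 0 < s -> {for s, continuous (fun s => x0 / Gamma gam * s `^ (gam - 1))}.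
  move=> s0; apply: (@continuousM _ _ (cst (x0 / Gamma gam)) (fun s => s `^ (gam - 1))).
    exact: cst_continuous.
  exact: powR_continuous.
have Phi_cont (y : R -> R) s : 0 < s -> {for s, continuous y} ->
    {for s, continuous (fun u => phi (q u) (y u))}.
  move=> s0 cy; apply: (continuous_phi_comp phi_cont) => //.
    exact: kat_inv_gt0.
  exact: kat_inv_continuous.
have Phi_lip u v w : 0 < u -> `|phi (q u) v - phi (q u) w| <= A * `|v - w|.
  by move=> u0; apply: phi_lip; exact: kat_inv_gt0.
have al01 : 0 < alpha <= 1 by case/andP: alpha_itv => -> /ltW.
have [r' rr' [Y [YX cY Yl YE]]] := @volterra_extension R alpha A (p r)
  (fun u v => phi (q u) v) _ (x \o q) al01 A_gt0 pr0 Phi_lip Phi_cont g_cont cX Xl Xb XE.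
have r'0 : 0 < r' by exact: lt_trans rr'.
pose xh t := Y (p t).
pose b := q r'.
have rb : r < b by rewrite -[ltLHS](kat_varK rho0 r0) /b kat_inv_lt.
have b0 : 0 < b by exact: lt_trans rb.
have pb : p b = r' by rewrite /p /b /q kat_invK.
have ptr' t : 0 < t < b -> 0 < p t < r'.
  by move=> /andP[t0 tb]; rewrite -pb kat_var_gt0//= kat_var_lt.
have xhx t : 0 < t < r -> xh t = x t.
  move=> /andP[t0 tr]; rewrite /xh YX; last by rewrite kat_var_gt0//= kat_var_lt.
  by rewrite /= /p /q kat_varK.
have cxh t : 0 < t < b -> {for t, continuous xh}.
  move=> tb; apply: (@continuous_comp _ _ _ p Y); last exact/cY/ptr'.
  by apply: kat_var_continuous => //; case/andP: tb.
have Yq s : 0 < s -> xh (q s) = Y s by move=> s0; rewrite /xh /p /q kat_invK.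
have [xC xeq xlim] := xsol.
exists b%:E, xh; split => //; last first.
- by move=> t t0; rewrite lte_fin => tr; rewrite xhx// t0.
split.
- move=> c c0; rewrite lte_fin => cb.
  have h0 : 0 < r / 2 by rewrite divr_gt0.
  have hr : r / 2 < r by lra.
  apply: (in_Cw_glue c0 h0 (xC _ h0 _)).
  + by rewrite lte_fin.
  + by move=> t /andP[t0 th]; apply: xhx; rewrite t0 (le_lt_trans th).
  + by move=> t /andP[t0 tc]; apply: cxh; rewrite t0 (le_lt_trans tc).
- right; apply: (abel_volterra alpha_itv rho0 phi_cont b0 cxh).
  + rewrite -/p pb; apply: eq_locint Yl.
    by move=> u /andP[u0 _]; rewrite -/q Yq.
  + move=> s; rewrite -/p pb => sr'; have /andP[s0 _] := sr'.
    rewrite -/q Yq// (YE s sr') -/gam.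
    have E : rl alpha (fun u => phi (q u) (Y u)) s = rl alpha (fun u => phi (q u) (xh (q u))) s.
      by apply: eq_rl => // u /andP[u0 _]; rewrite Yq.
    by rewrite E.
- apply: (cvg_at_right0_eq r0) xlim => t /andP[t0 tr].
  rewrite /kat_integral; case: ifP => _; first by rewrite xhx// t0.
  congr (_ * _); apply: eq_Rintegral => u; rewrite inE/= in_itv/= => /andP[u0 ut].
  by rewrite /kat_integrand xhx// u0 (lt_trans ut).
Qed.
End Solutions.

Theorem theorem4p2 (R : realType) (alpha beta rho x0 A lambda T : R)
    (phi : R -> R -> R) (mu : \bar R) (x : R -> R)
    (alpha_itv : 0 < alpha < 1) (beta_itv : 0 <= beta <= 1)
    (rho_gt0 : 0 < rho)
    (phi_cont : {within [set p : R * R | 0 < p.1],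
                   continuous (fun p => phi p.1 p.2)})
    (A_gt0 : 0 < A)
    (phi_lip : forall t u v : R, 0 < t ->
       `|phi t u - phi t v| <= A * `|u - v|)
    (lambda_itv : 0 <= lambda < 1) (T_gt0 : 0 < T)
    (phi_map : continuous_bounded_map rho (hk_gamma alpha beta) T
       (fun y t => t `^ lambda * phi t (y t)))
    (mu_gt0 : (0 < mu)%E)
    (x_sol : is_solution rho alpha beta x0 phi mu x) :
  noncontinuable rho alpha beta x0 phi mu x <->
  limf_esup (fun t : R => (Num.sqrt (t ^+ 2 + x t ^+ 2))%:E) (left_nbhs mu) = +oo%E.
Proof.
have sqrt_t t : t <= Num.sqrt (t ^+ 2 + x t ^+ 2).
  rewrite (le_trans (ler_norm _))// -sqrtr_sqr ler_wsqrtr// lerDl; exact: sqr_ge0.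
have sqrt_x t : `|x t| <= Num.sqrt (t ^+ 2 + x t ^+ 2).
  by rewrite -sqrtr_sqr ler_wsqrtr// lerDr; exact: sqr_ge0.
split.
  move=> nc; apply: contrapT => /limf_esup_fin_bound[V FV [M VM]].
  case: mu mu_gt0 x_sol nc FV => [r| |] //= mu0 xs nc FV.
    have [d d0 dV] := near_at_left FV.
    apply: nc; apply: (bounded_continuation alpha_itv beta_itv rho_gt0 phi_cont A_gt0 phi_lip _ xs d0).
      by rewrite -lte_fin.
    by move=> t /dV/VM; exact: le_trans (sqrt_x t).
  case: FV => K [_ KV].
  have /KV/VM : K < Num.max K M + 1 by rewrite ltr_pwDr// le_max lexx.
  rewrite leNgt => /negP; apply; apply: lt_le_trans (sqrt_t _).
  by rewrite ltr_pwDr// le_max lexx orbT.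
move=> lim [muh [xh [_ xhs mumuh xxh]]].
case: mu mu_gt0 x_sol lim mumuh xxh => [r| |] //= mu0 xs lim mumuh xxh; last first.
  by move: mumuh; rewrite ltNge leey.
move: mu0; rewrite lte_fin => r0.
have [b rb bmuh] : exists2 b, r < b & (b%:E < muh)%E.
  case: muh mumuh {xhs} => [s| |] //.
    by rewrite lte_fin => rs; exists ((r + s) / 2); rewrite ?lte_fin; lra.
  by move=> _; exists (r + 1); [rewrite ltrDl|exact: ltry].
have b0 := lt_trans r0 rb.
have [_ cxh] := solution_abel alpha_itv beta_itv rho_gt0 phi_cont xhs b0 bmuh.
have cr : {for r, continuous xh} by apply: cxh; rewrite r0.
have near1 : \forall t \near r^'-, `|xh r - xh t| < 1.
  by move/cvg_at_left_filter/cvgrPdist_lt: cr => /(_ 1 ltr01).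
pose M := `|xh r| + 1.
have : (limf_esup (fun t : R => (Num.sqrt (t ^+ 2 + x t ^+ 2))%:E) r^'- <=
        (Num.sqrt (r ^+ 2 + M ^+ 2))%:E)%E.
  apply: (@limf_esup_le _ _ _ [set t | 0 < t < r /\ `|xh r - xh t| < 1]).
    near=> t; split.
      by apply/andP; split; near: t; [exact: nbhs_left_gt|exact: nbhs_left_lt].
    by near: t; exact: near1.
  move=> t [/andP[t0 tr] xht]; rewrite lee_fin ler_wsqrtr// lerD//.
    by rewrite lerXn2r ?nnegrE// ltW.
  rewrite -real_normK ?num_real// xxh ?lte_fin// lerXn2r ?nnegrE ?addr_ge0//.
  rewrite -[xh t](subKr (xh r)) (le_trans (ler_normB _ _))// lerD2l.
  exact: ltW.
by rewrite lim leye_eq.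
Unshelve. all: by end_near. Qed.
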